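(* Assume that the stationary point process $\Psi$ on $\mathbb{R}$ is Brillinger-mixing. Further suppose that $\mathbb{E}R_0<\infty$ and that $\Phi_0\sim G$ has a continuous distribution function $G$. Then $$\mathbb{E}\left(\frac{|\Xi\cap\rho K|_2}{|\rho K|_2}-\bigl(1-\exp\{-\lambda\,\mathbb{E}|\Xi_0|_1\}\bigr)\right)^2\longrightarrow 0\quad\text{as }\rho\to\infty,\qquad\text{where }\Xi_0:=[-R_0,R_0].$$
   Context: Setting. $|\cdot|_k$ is Lebesgue measure on $\mathbb{R}^k$. $\Psi=\sum_{i\in\mathbb{Z}}\delta_{P_i}$ is a simple, locally finite stationary point process on $\mathbb{R}$ with intensity $\lambda=\mathbb{E}\Psi([0,1])\in(0,\infty)$. $(\Phi_0,R_0)$ is a random vector in $[0,\pi]\times[0,\infty)$ with independent components, $\Phi_0\sim G$, $R_0\sim F$. $\{(\Phi_i,R_i):i\in\mathbb{Z}\}$ are i.i.d. copies of $(\Phi_0,R_0)$, independent of $\Psi$; they serve as marks of the points $P_i$. For $p\in\mathbb{R}$ and an angle $\varphi$, $v(\varphi)=(\cos\varphi,\sin\varphi)^T$ and $g(p,\varphi)=\{(x,y)\in\mathbb{R}^2: x\cos\varphi+y\sin\varphi=p\}$; $b(\mathbf{o},r)$ is the closed disc of radius $r\ge 0$ centred at the origin $\mathbf{o}$; $\oplus$ is Minkowski sum. The cylinder process is $\Xi=\bigcup_{i\in\mathbb{Z}}\bigl(g(P_i,\Phi_i)\oplus b(\mathbf{o},R_i)\bigr)$. $K\subset\mathbb{R}^2$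 is a fixed compact set, star-shaped with respect to $\mathbf{o}$, and $\mathbf{o}$ is an inner point of $K$; $\rho\ge1$ is a scaling factor. Cumulant measures. For $k\ge1$ with $\mathbb{E}\Psi([0,1])^k<\infty$, $\alpha^{(k)}$ is the $k$th-order factorial moment measure of $\Psi$: $\alpha^{(k)}(B_1\times\dots\times B_k)=\mathbb{E}\sum^{\neq}_{i_1,\dots,i_k}\prod_{j=1}^k\mathbf{1}_{B_j}(P_{i_j})$ (sum over pairwise distinct indices). The factorial cumulant measures are the locally finite signed measures $\gamma^{(k)}(\times_{i=1}^kB_i)=\sum_{\ell=1}^k(-1)^{\ell-1}(\ell-1)!\sum_{K_1\cup\dots\cup K_\ell=\{1,\dots,k\}}\prod_{j=1}^\ell\alpha^{(\#K_j)}(\times_{i\in K_j}B_i)$, the inner sum running over all partitions of $\{1,\dots,k\}$ into $\ell$ disjoint non-empty subsets. For $k\ge 2$ the reduced cumulant measure $\gamma^{(k)}_{red}$ is the unique signed measure on $\mathbb{R}^{k-1}$ with $\gamma^{(k)}(\times_{i=1}^kB_i)=\lambda\int_{B_1}\gamma^{(k)}_{red}(\times_{i=2}^k(B_i-p))\,dp$ for all bounded Borel sets $B_1,\dots,B_k\subset\mathbb{R}$; $\|\gamma^{(k)}_{red}\|_{TV}=|\gamma^{(k)}_{red}|(\mathbb{R}^{k-1})$ is its total variation. Brillinger-mixing: $\mathbb{E}\Psi([0,1])^k<\infty$ and $\|\gamma^{(k)}_{red}\|_{TV}<\infty$ for all $k\ge2$. *)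

(* Defs.v *)
From HB Require Import structures.
From mathcomp Require Export all_boot all_order all_algebra.
From mathcomp Require Export all_classical all_reals all_analysis.
Export Order.TTheory GRing.Theory Num.Theory numFieldNormedType.Exports.

Set Implicit Arguments.
Unset Strict Implicit.
Unset Printing Implicit Defensive.

Local Open Scope classical_set_scope.
Local Open Scope ring_scope.
Local Open Scope ereal_scope.

Section Independence.
Context {d : measure_display} {T : measurableType d} {R : realType}.
Variable P : probability T R.

Definition mutually_independent {I : choiceType} {d'} {S : measurableType d'}
    (X : I -> T -> S) : Prop :=
  forall (J : seq I) (B : I -> set S), uniq J -> (forall i, measurable (B i)) ->
    P (\bigcap_(i in [set` J]) X i @^-1` B i) = \prod_(i <- J) P (X i @^-1` B i).

Definition identically_distributed {I : Type} {d'} {S : measurableType d'}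
    (X : I -> T -> S) : Prop :=
  forall (i j : I) (B : set S), measurable B ->
    P (X i @^-1` B) = P (X j @^-1` B).

Definition independent_variables {d1 d2} {S1 : measurableType d1}
    {S2 : measurableType d2} (X : T -> S1) (Y : T -> S2) : Prop :=
  forall (A : set S1) (B : set S2), measurable A -> measurable B ->
    P (X @^-1` A `&` Y @^-1` B) = P (X @^-1` A) * P (Y @^-1` B).

Definition family_sigma_algebra {I : Type} {d'} {S : measurableType d'}
    (X : I -> T -> S) : set (set T) :=
  <<s \bigcup_i preimage_set_system setT (X i) measurable >>.

Definition independent_families {I1 I2 : Type} {d1 d2}
    {S1 : measurableType d1} {S2 : measurableType d2}
    (X : I1 -> T -> S1) (Y : I2 -> T -> S2) : Prop :=
  forall E F : set T, family_sigma_algebra X E -> family_sigma_algebra Y F ->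
    P (E `&` F) = P E * P F.

End Independence.

(* A locally finite signed measure on R^n, given by its Jordan decomposition
   into mutually singular locally finite measures.  Its value [sm_pos - sm_neg]
   is meaningful on bounded Borel sets; on unbounded sets both parts may be
   infinite. *)
Record signed_measure (R : realType) (n : nat) := SignedMeasure {
  sm_pos : {measure set (n.-tuple R) -> \bar R};
  sm_neg : {measure set (n.-tuple R) -> \bar R};
  sm_locally_finite : forall r : R,
    let box := [set t : n.-tuple R | forall i, (`|tnth t i| <= r)%R] in
    sm_pos box < +oo /\ sm_neg box < +oo;
  sm_singular : exists D : set (n.-tuple R),
    [/\ measurable D, sm_pos (~` D) = 0 & sm_neg D = 0] }.

Definition sm_val (R : realType) n (nu : signed_measure R n)
    (A : set (n.-tuple R)) : \bar R := sm_pos nu A - sm_neg nu A.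

Definition total_variation (R : realType) n (nu : signed_measure R n) : \bar R :=
  sm_pos nu setT + sm_neg nu setT.

(* The point process is given by a measurable enumeration of its points,
   Psi = \sum_(i in Z) delta_(X i). *)
Section PointProcess.
Context {d : measure_display} {T : measurableType d} {R : realType}.
Variables (P : probability T R) (X : int -> {RV P >-> R}).

Definition Psi (w : T) (B : set R) : \bar R :=
  \esum_(i in [set: int]) \d_(X i w) B.

Definition simple_process : Prop :=
  {ae P, forall w, injective (fun i => X i w)}.

Definition locally_finite_process : Prop :=
  {ae P, forall w, forall B : set R, measurable B -> bounded_set B ->
    Psi w B < +oo}.

(* Psi and its translates have the same finite-dimensional distributions, that
   is, the same distribution on the space of locally finite counting
   measures. *)
Definition stationary_process : Prop :=
  forall (x : R) (n : nat) (B : 'I_n -> set R) (c : 'I_n -> nat),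
    (forall j, measurable (B j) /\ bounded_set (B j)) ->
    P [set w | forall j, Psi w [set (p + x)%R | p in B j] = (c j)%:R%:E] =
    P [set w | forall j, Psi w (B j) = (c j)%:R%:E].

Definition intensity : \bar R := \int[P]_w Psi w `[0%R, 1%R].

(* alpha^(k) (B_1 x ... x B_k) *)
Definition factorial_moment (k : nat) (B : 'I_k -> set R) : \bar R :=
  \int[P]_w \esum_(i in [set i : {ffun 'I_k -> int} | injective i])
    (\prod_(j < k) \1_(B j) (X (i j) w))%R%:E.

(* gamma^(k) (B_1 x ... x B_k), for bounded Borel sets B_i.  Partitions of the
   index set are sets of blocks, and [enum_val] lists the indices of a block;
   [fine] is harmless because the factorial moments involved are finite when
   Psi is stationary and E Psi([0,1])^k < +oo. *)
Definition factorial_cumulant (k : nat) (B : 'I_k -> set R) : R :=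
  (\sum_(1 <= l < k.+1) (-1) ^+ l.-1 * (l.-1)`!%:R *
     \sum_(pi : {set {set 'I_k}} | finset.partition pi [set: 'I_k]%SET && (#|pi| == l))
       \prod_(K in pi)
         fine (factorial_moment (fun j : 'I_#|K| => B (enum_val j))))%R.

(* nu = gamma^(n+1)_red, a signed measure on R^n. *)
Definition reduced_cumulant (n : nat) (nu : signed_measure R n) : Prop :=
  forall B : 'I_n.+1 -> set R,
    (forall i, measurable (B i) /\ bounded_set (B i)) ->
    (factorial_cumulant B)%:E =
    intensity * \int[lebesgue_measure]_(p in B ord0)
      sm_val nu [set t | forall i : 'I_n, B (lift ord0 i) (tnth t i + p)%R].

Definition Brillinger_mixing : Prop :=
  forall n : nat, (1 <= n)%N ->
    \int[P]_w (Psi w `[0%R, 1%R] ^+ n.+1) < +oo /\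
    exists nu : signed_measure R n,
      reduced_cumulant nu /\ total_variation nu < +oo.

End PointProcess.

Section Cylinders.
Context {R : realType}.
Implicit Types (p phi r rho : R) (A B K : set (R * R)).

Definition line p phi : set (R * R) :=
  [set z | z.1 * cos phi + z.2 * sin phi = p]%R.

Definition disc r : set (R * R) := [set z | 0 <= r /\ z.1 ^+ 2 + z.2 ^+ 2 <= r ^+ 2]%R.

Definition minkowski_sum A B : set (R * R) :=
  [set z | exists2 a, A a & exists2 b, B b & z = a + b]%R.

Definition dilate rho K : set (R * R) :=
  [set (rho * z.1, rho * z.2)%R | z in K].

Definition star_shaped K : Prop :=
  forall z, K z -> forall t : R, (0 <= t <= 1)%R -> K (t * z.1, t * z.2)%R.

Definition area A : \bar R := (lebesgue_measure \x lebesgue_measure) A.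

End Cylinders.

Definition cylinder_process {d : measure_display} {T : measurableType d}
    {R : realType} {P : probability T R} (X Phi Rad : int -> {RV P >-> R})
    (w : T) : set (R * R) :=
  \bigcup_(i in [set: int])
    minkowski_sum (line (X i w) (Phi i w)) (disc (Rad i w)).

(* Main.v *)
From HB Require Import structures.
From mathcomp Require Import ring lra measurable_realfun measurable_fun_approximation.
Require Import Defs.

Set Implicit Arguments.
Unset Strict Implicit.
Unset Printing Implicit Defensive.

Local Open Scope classical_set_scope.
Local Open Scope ring_scope.
Local Open Scope ereal_scope.

(** The uncovered fraction of [rho K] is the mean over [u] in [K] of the
    indicator that [rho u] lies in no cylinder, so its first two moments are
    averages of the probabilities that one point, or two points, are uncovered.
    Put [q = exp (- lambda E |Xi_0|)].  By dominated convergence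
    ([mean_square_sections]) it suffices that, as [rho] grows, the point [rho u]
    is uncovered with probability tending to [q] for [u] nonzero, and the points
    [rho u] and [rho u'] are both uncovered with probability tending to [q ^+ 2]
    for distinct nonzero [u] and [u'].

    Both are void probabilities of the marked process: a cylinder with position
    [p], angle [phi] and radius [r] hits [z] if and only if
    [|<z, v(phi)> - p| <= r], that is, if the marked point falls into a set [J]
    ([strip], or [strip2] for two points) whose section at each mark is bounded.
    Let [w p] be the probability that a point at [p] receives a mark putting it
    into [J].  The marks being independent, the void probability is
    [E prod_i (1 - w (X i))] ([thinning_formula]).  The product is
    [exp (- sum_i w (X i))] up to [sum_i w (X i) ^+ 2] ([prod_sub1_expR]), and it
    remains to see that the sum concentrates at its mean [c = lambda a], where
    [a] is the integral of [w], equal to the mean length of the sections of [J].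
    The mean is given by the Campbell formula ([Campbell]).  For the variance
    only mixing of order two is needed: the reduced covariance measure has
    finite total variation, and since [w] is a mixture of indicators of bounded
    sets, the variance is at most a constant times [a * sup w]
    ([second_order_bound], [sum_section_prob_pair_le]).  Hence the void
    probability differs from [exp (- lambda a)] by an error that vanishes with
    [sup w] ([void_probability]).

    As [rho] grows, [sup w] vanishes.  Indeed [w p ^+ 2] is the probability that
    two independent marks both put a point at [p] into [J], which for
    [z = rho u] forces [rho |Y - Y'| <= r + r'] with [Y], [Y'] independent copies
    of [<u, v(Phi_0)>].  This probability does not depend on [p] and tends to
    [P (Y = Y') = 0], because [Y] has no atoms ([proj_no_atom]): the distribution
    function of [Phi_0] is continuous and each level set of the projection
    contains at most two angles of [[0, pi]].  Moreover [a = E |Xi_0|] for one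
    point.  For two points the two sections overlap only if
    [rho |<u - u', v(phi)>| <= 2 r], so that [a] tends to [2 E |Xi_0|]
    ([cvg_strip2_mean]), which yields the limit [q ^+ 2]. *)

(** * Elementary inequalities *)

Section RealInequalities.
Context {R : realType}.
Implicit Types x y : R.
Local Open Scope ring_scope.

Lemma expRN_sub1_bounds x : 0 <= x <= 1 -> 0 <= expR (- x) - (1 - x) <= x ^+ 2.
Proof.
move=> /andP[x0 x1]; apply/andP; split.
  by rewrite subr_ge0; exact: expR_ge1Dx.
have p : 0 < 1 + x by rewrite ltr_wpDr.
suff : expR (- x) <= 1 - x + x ^+ 2 by lra.
have : expR (- x) * (1 + x) <= 1.
  have : expR (- x) * (1 + x) <= expR (- x) * expR x.
    by rewrite ler_pM2l ?expR_gt0// expR_ge1Dx.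
  by rewrite -expRD addNr expR0.
have : 1 <= (1 - x + x ^+ 2) * (1 + x) by nra.
by move=> h1 h2; have := le_trans h2 h1; rewrite ler_pM2r.
Qed.

(** A product of factors close to 1 is close to the exponential of minus the
    sum of the defects, with a quadratic error. *)
Lemma prod_sub1_expR (I : Type) (s : seq I) (w : I -> R) :
  (forall i, 0 <= w i <= 1) ->
  `|\prod_(i <- s) (1 - w i) - expR (- \sum_(i <- s) w i)|
    <= \sum_(i <- s) w i ^+ 2.
Proof.
move=> w01; elim: s => [|i s IH]; first by rewrite !big_nil oppr0 expR0 subrr normr0.
rewrite !big_cons opprD expRD.
set p := \prod_(j <- s) _ in IH *; set e := expR (- \sum_(j <- s) _) in IH *.
have /andP[wi0 wi1] := w01 i; have /andP[h0 h1] := expRN_sub1_bounds (w01 i).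
have e0 : 0 <= e by exact: expR_ge0.
have e1 : e <= 1 by rewrite expR_le1 oppr_le0 sumr_ge0// => j _; case/andP: (w01 j).
have -> : (1 - w i) * p - expR (- w i) * e =
  (1 - w i) * (p - e) - (expR (- w i) - (1 - w i)) * e by ring.
apply: le_trans (ler_normB _ _) _.
rewrite !normrM (ger0_norm h0) (ger0_norm e0).
have -> : `|1 - w i| = 1 - w i by rewrite ger0_norm// subr_ge0.
rewrite addrC; apply: lerD.
  by apply: le_trans h1; rewrite ler_piMr.
by apply: le_trans IH; rewrite ler_piMl// lerBlDr lerDl.
Qed.

Lemma expRN_lipschitz x y : 0 <= x -> 0 <= y ->
  `|expR (- x) - expR (- y)| <= `|x - y|.
Proof.
wlog xy : x y / x <= y => [H x0 y0|x0 y0].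
  have [/H|/ltW yx] := leP x y; first exact.
  by rewrite distrC [leRHS]distrC; exact: H.
rewrite [leRHS]distrC (ger0_norm (_ : 0 <= y - x)) ?subr_ge0//.
rewrite ger0_norm ?subr_ge0 ?ler_expR ?lerN2//.
have -> : expR (- y) = expR (- x) * expR (- (y - x)).
  by rewrite -expRD; congr expR; ring.
have := expR_ge1Dx (- (y - x)); set e := expR (- (y - x)) => h.
have : expR (- x) <= 1 by rewrite expR_le1 oppr_le0.
have : 0 < expR (- x) by exact: expR_gt0.
have : e <= 1 by rewrite expR_le1 oppr_le0 subr_ge0.
by nra.
Qed.

(** The elementary form of the Cauchy-Schwarz inequality used to pass from a
    second moment to a first absolute moment. *)
Lemma norm_le_young (eta : R) y : 0 < eta -> `|y| <= eta + y ^+ 2 / eta.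
Proof.
move=> eta0; rewrite -(ler_pM2r eta0) mulrDl divfK ?gt_eqF//.
rewrite -(real_normK (num_real y)); have : 0 <= `|y| by [].
by set z := `|y| => z0; nra.
Qed.

End RealInequalities.

(** * Independent marking *)

Lemma bigcap_seq_cons (I : choiceType) (T : Type) (i : I) (s : seq I) (F : I -> set T) :
  \bigcap_(j in [set` i :: s]) F j = F i `&` \bigcap_(j in [set` s]) F j.
Proof. by rewrite !bigcap_seq big_cons. Qed.

Section Thinning.
Context {d : measure_display} {T : measurableType d} {R : realType}.
Variable P : probability T R.
Context {d1 d2 : measure_display} {S1 : measurableType d1} {S2 : measurableType d2}.
Context {I : choiceType}.
Variables (X : I -> T -> S1) (M : I -> T -> S2) (mu : probability S2 R).
Hypothesis mX : forall i, measurable_fun setT (X i).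
Hypothesis mM : forall i, measurable_fun setT (M i).
Hypothesis M_law : forall i B, measurable B -> P (M i @^-1` B) = mu B.
Hypothesis M_indep : mutually_independent P M.
Hypothesis XM_indep : independent_families P X M.

Lemma family_sigma_algebra_setI d' (S : measurableType d') (Y : I -> T -> S) E F :
  family_sigma_algebra Y E -> family_sigma_algebra Y F ->
  family_sigma_algebra Y (E `&` F).
Proof. exact: (@measurableI _ (g_sigma_algebraType _)). Qed.

Lemma family_sigma_algebra_preimage d' (S : measurableType d') (Y : I -> T -> S)
    i (B : set S) : measurable B -> family_sigma_algebra Y (Y i @^-1` B).
Proof.
move=> mB; apply: sub_sigma_algebra; exists i => //.
by exists B => //; rewrite setTI.
Qed.

Lemma family_sigma_algebraT d' (S : measurableType d') (Y : I -> T -> S) :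
  family_sigma_algebra Y setT.
Proof. exact: (@measurableT _ (g_sigma_algebraType _)). Qed.

Lemma family_sigma_algebra_measurable d' (S : measurableType d') (Y : I -> T -> S) E :
  (forall i, measurable_fun setT (Y i)) ->
  family_sigma_algebra Y E -> measurable E.
Proof.
move=> mY; apply: (@smallest_sub _ _ _ measurable); first exact: sigma_algebra_measurable.
move=> _ [i _ [B mB <-]]; exact: mY.
Qed.

Section OneStep.
Variables (D E : set T) (h : T -> R) (k : R) (i : I).
Hypotheses (mD : measurable D) (mE : measurable E).
Hypothesis mh : measurable_fun setT h.
Hypothesis h0 : forall w, (0 <= h w)%R.
Hypothesis k0 : (0 <= k)%R.

Let XM w := (X i w, M i w).

Let mXM : measurable_fun setT XM.
Proof. exact: measurable_fun_pair. Qed.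

(** The right-hand side of the marking formula as a function of the set [C]
    of admissible values of the marked point [i]; [h] collects the factors of
    the marked points already treated and [k] those of the marks of [D]. *)
Definition section_integral (C : set (S1 * S2)) : \bar R :=
  k%:E * \int[P]_(w in E) (mu (xsection C (X i w)) * (h w)%:E).

Let mF C : measurable C ->
  measurable_fun E (fun w => mu (xsection C (X i w)) * (h w)%:E).
Proof.
move=> mC; apply: (measurable_funS measurableT) => //.
apply: emeasurable_funM => //; last exact/measurable_EFinP.
apply: (measurableT_comp (f := fun x => mu (xsection C x))) => //.
exact: measurable_fun_xsection.
Qed.

Let F0 C w : 0 <= mu (xsection C (X i w)) * (h w)%:E.
Proof. by rewrite mule_ge0// lee_fin. Qed.

Let si0 : section_integral set0 = 0.
Proof.
rewrite /section_integral integral0_eq ?mule0// => w _.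
by rewrite xsection0 measure0 mul0e.
Qed.

Let si_ge0 C : 0 <= section_integral C.
Proof. by rewrite /section_integral mule_ge0 ?lee_fin// integral_ge0// => w _; exact: F0. Qed.

Let si_sigma_additive : semi_sigma_additive section_integral.
Proof.
move=> F mFn tF mUF; rewrite /section_integral.
have -> : k%:E * \int[P]_(w in E) (mu (xsection (\bigcup_n F n) (X i w)) * (h w)%:E) =
    \sum_(n <oo) k%:E * \int[P]_(w in E) (mu (xsection (F n) (X i w)) * (h w)%:E).
  rewrite nneseriesZl//; last by move=> n _; rewrite integral_ge0// => w _; exact: F0.
  congr (_ * _); rewrite -integral_nneseries//; last by move=> n; exact: mF.
  apply: eq_integral => w _.
  rewrite xsection_bigcup measure_semi_bigcup//; last 3 first.
  - by move=> n; exact: measurable_xsection.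
  - exact: trivIset_xsection.
  - by apply: bigcup_measurable => n _; exact: measurable_xsection.
  rewrite muleC -nneseriesZl//.
  by apply: eq_eseriesr => n _; rewrite muleC.
apply: is_cvg_nneseries => n _ _.
exact: si_ge0.
Qed.

HB.instance Definition _ := isMeasure.Build _ _ _ section_integral
  si0 si_ge0 si_sigma_additive.

Hypothesis rectangles : forall A B, measurable A -> measurable B ->
  P (D `&` (X i @^-1` A `&` M i @^-1` B)) = section_integral (A `*` B).

(** Two finite measures that agree on rectangles are equal. *)
Lemma section_integral_eq (C : set (S1 * S2)) : measurable C ->
  P (D `&` [set w | C (X i w, M i w)]) = section_integral C.
Proof.
move=> mC.
pose m1 : {measure set (S1 * S2) -> \bar R} := pushforward (mrestr P mD) XM.
have -> : P (D `&` [set w | C (X i w, M i w)]) = m1 mXM C.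
  by rewrite /m1 /= /pushforward /mrestr setIC.
pose G : set (set (S1 * S2)) := 
  [set C | exists A, measurable A /\ exists B, measurable B /\ C = A `*` B].
apply: (measure_unique G (fun=> setT) _ _ _ _ (m1 mXM)) => //.
- rewrite measurable_prod_measurableType //; congr (<<s _ >>).
  rewrite predeqE; split => [[A mA [B mB <-]]|[A [mA [B [mB ->]]]]].
    by exists A; split => //; exists B.
  by exists A => //; exists B.
- move=> /= _ _ [X1 [mX1 [X2 [mX2 ->]]]] [Y1 [mY1 [Y2 [mY2 ->]]]].
  rewrite -setXI; exists (X1 `&` Y1); split; first exact: measurableI.
  by exists (X2 `&` Y2); split => //; exact: measurableI.
- by move=> n; exists setT; split => //; exists setT; split => //; rewrite setXTT.
- by apply/seteqP; split => // x _; exists 0%N.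
- move=> A [A1 [mA1 [A2 [mA2 ->]]]]; etransitivity; last exact: (rectangles mA1 mA2).
  by rewrite /m1 /= /pushforward /mrestr setIC.
- move=> _; rewrite /m1 /= /pushforward /mrestr preimage_setT setTI.
  by apply: (le_lt_trans (probability_le1 P mD)); exact: ltry.
Qed.

End OneStep.

(** Probability that the mark of a point at [x] belongs to the section of [C]
    at [x]; taken as a real number, which is harmless since it is at most 1. *)
Definition section_prob (C : set (S1 * S2)) (x : S1) : R :=
  fine (mu (xsection C x)).

Lemma section_prob_ge0 C x : (0 <= section_prob C x)%R.
Proof. exact: fine_ge0. Qed.

Lemma section_probE C x : measurable C -> (section_prob C x)%:E = mu (xsection C x).
Proof.
by move=> mC; rewrite fineK// fin_num_measure//; exact: measurable_xsection.
Qed.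

Lemma section_prob_le1 C x : measurable C -> (section_prob C x <= 1)%R.
Proof.
move=> mC; rewrite -lee_fin section_probE// probability_le1//.
exact: measurable_xsection.
Qed.

Lemma measurable_section_prob C : measurable C ->
  measurable_fun setT (section_prob C).
Proof.
move=> mC; apply: measurableT_comp => //; exact: measurable_fun_xsection.
Qed.

Lemma family_sigma_algebra_bigcap (s : seq I) d' (S : measurableType d')
    (Y : I -> T -> S) (B : I -> set S) : (forall i, measurable (B i)) ->
  family_sigma_algebra Y (\bigcap_(i in [set` s]) Y i @^-1` B i).
Proof.
move=> mB; elim: s => [|i s IH].
  by rewrite set_nil bigcap_set0; exact: family_sigma_algebraT.
rewrite bigcap_seq_cons; apply: family_sigma_algebra_setI => //.
exact: family_sigma_algebra_preimage.
Qed.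

(** The indices of [s2] carry events on the marks alone, those of [s1] general
    events on the marked points.  The induction moves one index at a time from
    [s1] to [s2]: for a rectangle the position part goes into [E] and the mark
    part into [s2], and [section_integral_eq] extends this to every set. *)
Lemma thinning_formula_rec (s1 s2 : seq I) (E : set T) (B : I -> set S2)
    (C : I -> set (S1 * S2)) :
  uniq (s1 ++ s2) -> (forall i, measurable (B i)) ->
  (forall i, measurable (C i)) -> family_sigma_algebra X E ->
  P (E `&` \bigcap_(i in [set` s2]) M i @^-1` B i
       `&` \bigcap_(i in [set` s1]) [set w | C i (X i w, M i w)]) =
  (\prod_(i <- s2) fine (mu (B i)))%:E *
  \int[P]_(w in E) (\prod_(i <- s1) section_prob (C i) (X i w))%:E.
Proof.
move=> + + mC; elim: s1 s2 E B => [|i s1 IH] s2 E B us mB sE.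
  have mE := family_sigma_algebra_measurable mX sE.
  rewrite set_nil bigcap_set0 setIT.
  under eq_integral do rewrite big_nil.
  rewrite integral_cst// mul1e XM_indep//; last exact: family_sigma_algebra_bigcap.
  rewrite M_indep// muleC; congr (_ * _).
  rewrite -prodEFin; apply: eq_bigr => i _.
  by rewrite M_law// fineK// fin_num_measure.
have mE := family_sigma_algebra_measurable mX sE.
have mXM j : measurable [set w | C j (X j w, M j w)].
  have := measurable_fun_pair (mX j) (mM j).
  by move=> /(_ measurableT _ (mC j)); rewrite setTI.
have mB2 : measurable (\bigcap_(j in [set` s2]) M j @^-1` B j).
  by apply: (@family_sigma_algebra_measurable _ _ M) => //;
     exact: family_sigma_algebra_bigcap.
have mC1 : measurable (\bigcap_(j in [set` s1]) [set w | C j (X j w, M j w)]).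
  by rewrite bigcap_seq; elim: (s1) => [|j s IHs];
    rewrite ?big_nil ?big_cons//; exact: measurableI.
set D := E `&` \bigcap_(j in [set` s2]) M j @^-1` B j
  `&` \bigcap_(j in [set` s1]) [set w | C j (X j w, M j w)].
rewrite bigcap_seq_cons (setIC [set w | _]) setIA -/D.
pose h w := (\prod_(j <- s1) section_prob (C j) (X j w))%R.
have mh : measurable_fun setT h.
  apply: measurable_prod => j _.
  by apply: measurableT_comp => //; exact: measurable_section_prob.
have h0 w : (0 <= h w)%R by apply: prodr_ge0 => j _; exact: section_prob_ge0.
have k0 : (0 <= \prod_(j <- s2) fine (mu (B j)))%R.
  by apply: prodr_ge0 => j _; exact: fine_ge0.
have := @section_integral_eq D E h _ i _ mE mh h0 k0 _ (C i) (mC i).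
move=> ->; last 2 first.
- by apply: measurableI => //; exact: measurableI.
- move=> A B0 mA mB0.
  pose B' j := if j == i then B0 else B j.
  have [iNs2 iNs1] : i \notin s2 /\ i \notin s1.
    by move: us => /= /andP[]; rewrite mem_cat negb_or => /andP[].
  have B'E j : j \in s2 -> B' j = B j.
    by rewrite /B'; case: eqP => // ->; rewrite (negbTE iNs2).
  have := IH (i :: s2) (E `&` X i @^-1` A) B'.
  rewrite (_ : P _ = P (D `&` (X i @^-1` A `&` M i @^-1` B0))); last first.
    congr (P _); rewrite bigcap_seq_cons /B' eqxx.
    rewrite (_ : \bigcap_(j in [set` s2]) _ =
      \bigcap_(j in [set` s2]) M j @^-1` B j); last first.
      by apply: eq_bigcapr => j /B'E; rewrite /B' => ->.
    by rewrite /D; apply/seteqP; split => w /=; tauto.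
  move=> ->; last 3 first.
  + by rewrite uniq_catC /= mem_cat orbC -mem_cat uniq_catC.
  + by move=> j; rewrite /B'; case: ifP.
  + by apply: family_sigma_algebra_setI => //; exact: family_sigma_algebra_preimage.
  rewrite big_cons {1}/B' eqxx.
  rewrite [X in (_ * X)%:E](eq_big_seq (fun j => fine (mu (B j)))); last first.
    by move=> j /B'E ->.
  rewrite /section_integral mulrC EFinM -muleA; congr (_ * _).
  rewrite -ge0_integralZl//; last 4 first.
  + by apply: measurableI => //; rewrite -[X in measurable X]setTI; exact: mX.
  + by apply/measurable_EFinP/(measurable_funS measurableT).
  + by move=> w _; rewrite lee_fin; exact: h0.
  + by rewrite lee_fin fine_ge0.
  rewrite integral_mkcondr.
  apply: eq_integral => w _.
  rewrite patchE; case: ifPn => wA.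
    by rewrite in_xsectionX// fineK// fin_num_measure.
  by rewrite notin_xsectionX// measure0 mul0e.
rewrite /section_integral; congr (_ * _); apply: eq_integral => w _.
by rewrite big_cons EFinM section_probE.
Qed.

(** Conditionally on the points, the marks are independent, so that the
    probability that all marked points of [s] lie in [C] is the expectation of
    a product. *)
Lemma thinning_formula (s : seq I) (C : set (S1 * S2)) :
  uniq s -> measurable C ->
  P (\bigcap_(i in [set` s]) [set w | C (X i w, M i w)]) =
  \int[P]_w (\prod_(i <- s) section_prob C (X i w))%:E.
Proof.
move=> us mC.
have := @thinning_formula_rec s [::] setT (fun=> setT) (fun=> C).
rewrite cats0 set_nil bigcap_set0 !setTI big_nil mul1e; apply => //.
exact: family_sigma_algebraT.
Qed.

End Thinning.

(** * Campbell formula of a stationary point process *)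

Lemma int_enumeration : exists e : nat -> int, set_bij [set: nat] [set: int] e.
Proof.
exists (fun n => if odd n then Negz n./2 else Posz n./2); split=> //.
  move=> m n _ _ h; rewrite -(odd_double_half m) -(odd_double_half n); move: h.
  by case: (odd m); case: (odd n) => // -[->].
move=> [m|m] _; [exists m.*2|exists m.*2.+1] => //=.
  by rewrite odd_double doubleK.
by rewrite odd_double /= uphalf_double.
Qed.

(** Tonelli's theorem for the measure of a set. *)
Lemma tonelli_sections d1 d2 (T1 : measurableType d1) (T2 : measurableType d2)
    (R : realType) (m1 : {sigma_finite_measure set T1 -> \bar R})
    (m2 : {sigma_finite_measure set T2 -> \bar R}) (A : set (T1 * T2)) :
  measurable A ->
  \int[m1]_x m2 (xsection A x) = \int[m2]_y m1 (ysection A y).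
Proof.
move=> mA; have := indic_fubini_tonelli m1 m2 mA.
by rewrite indic_fubini_tonelli_FE// indic_fubini_tonelli_GE.
Qed.

(** A measure known to be sigma-finite, repackaged with that structure. *)
Section SigmaFinitePack.
Context d (T : measurableType d) (R : realType).
Variable m : {measure set T -> \bar R}.
Hypothesis sm : sigma_finite setT m.

Definition sigma_finite_copy : set T -> \bar R := m.

HB.instance Definition _ := Measure.on sigma_finite_copy.
HB.instance Definition _ :=
  Measure_isSigmaFinite.Build _ _ _ sigma_finite_copy sm.

Lemma sigma_finite_pack :
  exists m0 : {sigma_finite_measure set T -> \bar R}, forall A, m0 A = m A.
Proof. by exists sigma_finite_copy. Qed.

End SigmaFinitePack.

Section Campbell.
Context {d : measure_display} {T : measurableType d} {R : realType}.
Variables (P : probability T R) (X : int -> {RV P >-> R}).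
Variable e : nat -> int.
Hypothesis e_bij : set_bij [set: nat] [set: int] e.

Lemma Psi_series w B : Psi X w B = \sum_(n <oo) \d_(X (e n) w) B.
Proof.
by rewrite /Psi (@reindex_esum _ _ _ _ _ _ _ e_bij) nneseries_esumT.
Qed.

Lemma Psi_ge0 w B : 0 <= Psi X w B.
Proof. by apply: esum_ge0 => i _. Qed.

(** A finite value of the counting measure is a natural number. *)
Lemma Psi_natural w B : Psi X w B < +oo -> exists c : nat, Psi X w B = c%:R%:E.
Proof.
rewrite Psi_series.
have -> : \sum_(n <oo) \d_(X (e n) w) B =
    counting [set n | B (X (e n) w)] :> \bar R.
  rewrite counting_dirac; apply: eq_eseriesr => n _.
  by rewrite !diracE; congr (_%:R%:E); apply/idP/idP; rewrite !inE.
rewrite /counting; case: ifP => [_ _|_]; last by rewrite ltxx.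
by eexists.
Qed.

Lemma measurable_dirac_RV (Y : {RV P >-> R}) B : measurable B ->
  measurable_fun setT (fun w => \d_(Y w) B : \bar R).
Proof.
move=> mB; apply: (measurableT_comp (f := fun x => \d_x B : \bar R)) => //.
exact: measurable_fun_dirac.
Qed.

Lemma measurable_Psi B : measurable B -> measurable_fun setT (fun w => Psi X w B).
Proof.
move=> mB; rewrite (_ : (fun w => _) = fun w => \sum_(n <oo) \d_(X (e n) w) B); last first.
  by apply/funext => w; rewrite Psi_series.
by apply: ge0_emeasurable_sum => // n _; exact: measurable_dirac_RV.
Qed.

(** The intensity measure of the point process. *)
Definition intensity_measure : {measure set R -> \bar R} :=
  mseries (fun n => distribution P (X (e n))) 0.

Lemma intensity_measureE B : measurable B ->
  intensity_measure B = \int[P]_w Psi X w B.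
Proof.
move=> mB; rewrite (eq_integral (fun w => \sum_(n <oo) \d_(X (e n) w) B)); last first.
  by move=> w _; rewrite Psi_series.
rewrite integral_nneseries//; last by move=> n; exact: measurable_dirac_RV.
apply: eq_eseriesr => n _; rewrite /distribution /pushforward.
have mXB : measurable (X (e n) @^-1` B).
  by rewrite -[X in measurable X]setTI; exact: measurable_funP.
rewrite -[LHS](mul1e (P (X (e n) @^-1` B))) -(integral_cst P mXB) [LHS]integral_mkcond.
apply: eq_integral => w _; rewrite patchE diracE.
have -> : (w \in X (e n) @^-1` B) = (X (e n) w \in B) by apply/idP/idP; rewrite !inE.
by case: ifP.
Qed.

Hypothesis X_locally_finite : locally_finite_process X.
Hypothesis X_stationary : stationary_process X.

(** Bounded Borel subsets of the line. *)
Definition bounded_Borel (B : set R) := measurable B /\ bounded_set B.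

(** The translate of [B] by [x]. *)
Definition shift_set (B : set R) (x : R) : set R := [set (p + x)%R | p in B].

Lemma shift_setE B x : shift_set B x = (fun p => (p - x)%R) @^-1` B.
Proof.
apply/seteqP; split => p /=; first by move=> [q Bq <-]; rewrite addrK.
by move=> Bp; exists (p - x)%R => //; rewrite subrK.
Qed.

Lemma bounded_Borel_shift B x : bounded_Borel B -> bounded_Borel (shift_set B x).
Proof.
move=> [mB bB]; split.
  rewrite shift_setE -[X in measurable X]setTI.
  by apply: measurable_funB.
case: bB => M [Mreal MB]; exists (M + `|x|)%R; split; first exact: num_real.
move=> N MN p [q Bq <-] /=; apply: (le_trans (ler_normD _ _)).
by rewrite -lerBrDr; apply: (MB (N - `|x|)%R) => //; rewrite ltrBrDr.
Qed.

(** The moments of the number of points in a bounded set are determined by the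
    one-dimensional distributions appearing in the definition of stationarity. *)
Lemma integral_Psi_distribution B (g : \bar R -> \bar R) : bounded_Borel B ->
  measurable_fun setT g -> (forall y, 0 <= y -> 0 <= g y) ->
  \int[P]_w g (Psi X w B) =
  \sum_(c <oo) (g c%:R%:E * P [set w | Psi X w B = c%:R%:E]).
Proof.
move=> [mB bB] mg g0.
have mPsi := measurable_Psi mB.
have gPsi0 w : 0 <= g (Psi X w B) by exact/g0/Psi_ge0.
pose F c := [set w | Psi X w B = c%:R%:E].
have mF c : measurable (F c).
  rewrite -[F c]setTI; exact: mPsi (emeasurable_set1 _).
have mgPsi : measurable_fun setT (fun w => g (Psi X w B)) by exact: measurableT_comp.
case: X_locally_finite => N [mN PN0 sN].
rewrite (ge0_negligible_integral mN)//.
have sNF : setT `\` N `<=` \bigcup_c F c.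
  move=> w [_ wN]; have /Psi_natural[c wc] : Psi X w B < +oo.
    by apply: contrapT => H; apply/wN/sN => /= K; apply/H/K.
  by exists c.
have -> : \int[P]_(w in setT `\` N) g (Psi X w B) =
    \int[P]_(w in \bigcup_c F c) g (Psi X w B).
  have mU : measurable (\bigcup_c F c) by exact: bigcup_measurable.
  rewrite [RHS](ge0_negligible_integral mN)//; last exact: measurable_funS mgPsi.
  congr (\int[P]_(w in _) _).
  apply/seteqP; split=> w /=; last by move=> [].
  by move=> wN; split; [exact: sNF|case: wN].
rewrite ge0_integral_bigcup//; last 2 first.
- by apply: measurable_funS mgPsi.
- move=> i j _ _ [w []]; rewrite /F /= => -> /eqP.
  by rewrite eqe eqr_nat => /eqP.
apply: eq_eseriesr => c _; rewrite -/(F c).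
rewrite (eq_integral (cst (g c%:R%:E))) ?integral_cst//.
by move=> w; rewrite inE => /= ->.
Qed.

Lemma integral_Psi_shift B x (g : \bar R -> \bar R) : bounded_Borel B ->
  measurable_fun setT g -> (forall y, 0 <= y -> 0 <= g y) ->
  \int[P]_w g (Psi X w (shift_set B x)) = \int[P]_w g (Psi X w B).
Proof.
move=> bB mg g0; rewrite !integral_Psi_distribution//; last exact: bounded_Borel_shift.
apply: eq_eseriesr => c _; congr (_ * _).
have := X_stationary x (B := fun _ : 'I_1 => B) (fun=> c) (fun=> bB).
have E C : [set w | forall j : 'I_1, Psi X w C = c%:R%:E] =
    [set w | Psi X w C = c%:R%:E].
  by apply/seteqP; split => w /=; [move/(_ ord0)|move=> ->].
by rewrite !E.
Qed.

Lemma intensity_measure_shift B x : bounded_Borel B ->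
  intensity_measure (shift_set B x) = intensity_measure B.
Proof.
move=> bB; have [mB' _] := bounded_Borel_shift x bB; have [mB _] := bB.
rewrite (intensity_measureE mB) (intensity_measureE mB').
by apply: (@integral_Psi_shift B x idfun) => //; exact: measurable_id.
Qed.

Variable lambda : R.
Hypothesis X_intensity : intensity X = lambda%:E.

Lemma bounded_Borel_itv a b (x y : R) :
  bounded_Borel [set` Interval (BSide a x) (BSide b y)].
Proof.
split; first exact: measurable_itv.
exists (`|x| + `|y|)%R; split; first exact: num_real.
move=> M hM z hz; apply: le_trans (ltW hM).
have [zx zy] : (x <= z)%R /\ (z <= y)%R.
  by move: hz; case: a; case: b; rewrite /= in_itv/= => /andP[h1 h2];
    rewrite ?h1 ?h2 ?(ltW h1) ?(ltW h2).
rewrite ler_norml; apply/andP; split.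
  rewrite lerNl; apply: le_trans (_ : - x <= _)%R; rewrite ?lerN2//.
  by apply: (le_trans (ler_norm _)); rewrite normrN lerDl.
by apply: (le_trans zy); apply: (le_trans (ler_norm _)); rewrite lerDr.
Qed.

Lemma intensity_measure01 : intensity_measure `[0%R, 1%R]%classic = lambda%:E.
Proof. by rewrite intensity_measureE. Qed.

Lemma intensity_measure_unit (a : R) :
  intensity_measure `[a, (a + 1)%R]%classic = lambda%:E.
Proof.
rewrite -intensity_measure01 -(intensity_measure_shift a (bounded_Borel_itv true false 0%R 1%R)).
congr (intensity_measure _); rewrite shift_setE; apply/seteqP; split => x /=;
  rewrite !in_itv/= => /andP[? ?]; apply/andP; split; lra.
Qed.

Lemma intensity_measure_cc_le (a : R) n :
  intensity_measure `[a, (a + n%:R)%R]%classic <= (n.+1%:R * lambda)%:E.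
Proof.
elim: n => [|n IH].
  rewrite addr0 mul1r -(intensity_measure_unit a) le_measure ?inE//.
  by apply: subset_itvl; rewrite bnd_simp lerDl.
have -> : (n.+2%:R * lambda)%:E = (n.+1%:R * lambda)%:E + lambda%:E.
  by rewrite -EFinD -[in LHS]natr1 mulrDl mul1r.
apply: le_trans (leeD IH (_ : intensity_measure `[(a + n%:R)%R, (a + n%:R + 1)%R]%classic <= _));
  last by rewrite intensity_measure_unit.
apply: le_trans (measureU2 _ _ _) => //.
apply: le_measure; rewrite ?inE//; first exact: measurableU.
move=> x /=; rewrite !in_itv/= -natr1 => /andP[ax xn].
have [?|/ltW ?] := leP x (a + n%:R)%R; [left|right].
  by rewrite ax.
by apply/andP; split => //; rewrite addrA in xn.
Qed.

Lemma intensity_measure_itv_fin a b (x y : R) :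
  intensity_measure [set` Interval (BSide a x) (BSide b y)] < +oo.
Proof.
have [n hn] : exists n, (y - x <= n%:R)%R.
  by exists (Num.truncn (y - x)).+1; exact/ltW/truncnS_gt.
apply: le_lt_trans (le_trans _ (intensity_measure_cc_le x n)) (ltry _).
apply: le_measure; rewrite ?inE//=.
by apply: subset_itv; case: a; case: b; rewrite bnd_simp//= -lerBlDl.
Qed.

Lemma intensity_measure_sigma_finite : sigma_finite setT intensity_measure.
Proof.
exists (fun n => `[(- n%:R)%R, n%:R%R]%classic); last first.
  by move=> n; split => //; exact: intensity_measure_itv_fin.
apply/esym; rewrite -subTset => x _; exists (Num.truncn `|x|).+1 => //=.
by rewrite in_itv/= -ler_norml ltW// truncnS_gt.
Qed.

(** The measure of the set of pairs [(x, y)] with [a < x <= b] and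
    [0 <= x + y <= 1] is computed in both orders of integration; this turns
    invariance under translations into proportionality to length. *)
Lemma intensity_measure_oc (a b : R) :
  intensity_measure `]a, b]%classic = lambda%:E * lebesgue_measure `]a, b]%classic.
Proof.
have [M ME] := sigma_finite_pack intensity_measure_sigma_finite.
pose L : {sigma_finite_measure set (measurableTypeR R) -> \bar R} := @lebesgue_measure R.
pose B := `]a, b]%classic; pose A : set R := `[0%R, 1%R]%classic.
pose C : set (R * R) := [set z | B z.1 /\ A (z.1 + z.2)%R].
pose C' : set (R * R) := [set z | A z.1 /\ B (z.1 - z.2)%R].
have mf : measurable_fun setT (fst : R * R -> R) by exact: measurable_fst.
have ms : measurable_fun setT (snd : R * R -> R) by exact: measurable_snd.
have mC : measurable C.
  apply: measurableI; rewrite -[X in measurable X]setTI.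
    by apply: mf => //; exact: measurable_itv.
  by apply: (measurable_funD mf ms) => //; exact: measurable_itv.
have mC' : measurable C'.
  apply: measurableI; rewrite -[X in measurable X]setTI.
    by apply: mf => //; exact: measurable_itv.
  by apply: (measurable_funB mf ms) => //; exact: measurable_itv.
transitivity (\int[M]_x L (xsection C x)).
  have mB : measurable B by exact: measurable_itv.
  rewrite -ME -[LHS](mul1e (M B)) -(integral_cst M mB) [LHS]integral_mkcond.
  apply: eq_integral => x _; rewrite patchE; case: ifPn => xB.
    rewrite (_ : xsection C x = `[(- x)%R, (1 - x)%R]%classic).
      rewrite /L /= lebesgue_measure_itv/= lte_fin ifT; last by lra.
      by rewrite -EFinD; congr (_%:E); ring.
    apply/seteqP; split => y; rewrite /xsection/= inE /C/A/=.
      by move=> [_]; rewrite !in_itv/= => /andP[? ?]; apply/andP; split; lra.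
    move=> h; split; first by rewrite inE in xB.
    by move: h; rewrite !in_itv/= => /andP[? ?]; apply/andP; split; lra.
  rewrite (_ : xsection C x = set0) ?measure0//.
  apply/seteqP; split => y //; rewrite /xsection/= inE => -[Bx _].
  by move: xB; rewrite notin_setE.
rewrite tonelli_sections//.
transitivity (\int[L]_y M (ysection C' y)).
  apply: eq_integral => y _; rewrite !ME.
  rewrite -(intensity_measure_shift y (B := ysection C y)); last first.
    split; first exact: measurable_ysection.
    have [N [Nreal HN]] : bounded_set B by exact: (bounded_Borel_itv _ _ _ _).2.
    exists N; split=> // M0 hM0 x; rewrite /ysection/= inE => -[Bx _].
    exact: HN Bx.
  congr (intensity_measure _); rewrite shift_setE.
  apply/seteqP; split => x; rewrite /ysection/= !inE /C/C'/= subrK; tauto.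
rewrite -tonelli_sections//.
rewrite -intensity_measure01 -!ME.
have mA : measurable A by exact: measurable_itv.
rewrite muleC -[RHS](integral_cst M mA) [RHS]integral_mkcond.
apply: eq_integral => x _; rewrite patchE; case: ifPn => xA.
  rewrite (_ : xsection C' x = `[(x - b)%R, (x - a)%R[%classic).
    rewrite /L /= !lebesgue_measure_itv/= !lte_fin.
    rewrite (_ : (x - b < x - a)%R = (a < b)%R); last by apply/idP/idP; lra.
    by case: ifP => // _; rewrite -!EFinD; congr (_%:E); ring.
  apply/seteqP; split => y; rewrite /xsection/= inE /C'/B/=.
    by move=> [_]; rewrite !in_itv/= => /andP[? ?]; apply/andP; split; lra.
  move=> h; split; first by rewrite inE in xA.
  by move: h; rewrite !in_itv/= => /andP[? ?]; apply/andP; split; lra.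
rewrite (_ : xsection C' x = set0) ?measure0//.
apply/seteqP; split => y //; rewrite /xsection/= inE => -[Bx _].
by move: xA; rewrite notin_setE.
Qed.

Hypothesis lambda_gt0 : (0 < lambda)%R.

Lemma intensity_measure_lebesgue B : measurable B ->
  intensity_measure B = lambda%:E * lebesgue_measure B.
Proof.
move=> mB.
have l0 : (0 <= lambda^-1)%R by rewrite invr_ge0 ltW.
pose iota : R -> measurableTypeR R := idfun.
have miota : measurable_fun setT iota by move=> _ Y mY; rewrite setTI.
pose m : {measure set (measurableTypeR R) -> \bar R} :=
  pushforward (mscale (NngNum l0) intensity_measure) iota.
rewrite (@lebesgue_measure_unique R (m miota))//.
  by rewrite /m /= /pushforward /mscale /= muleA -EFinM divff ?mul1e// gt_eqF.
move=> _ [[x y] _ <-]; rewrite /m /= /pushforward /mscale /=.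
rewrite -/(intensity_measure _) (_ : iota @^-1` _ = `]x, y]%classic)//.
by rewrite intensity_measure_oc muleA -EFinM mulVf ?mul1e// gt_eqF.
Qed.

Lemma Campbell (f : R -> \bar R) : measurable_fun setT f ->
  (forall x, 0 <= f x) ->
  \sum_(n <oo) \int[P]_w f (X (e n) w) = lambda%:E * \int[lebesgue_measure]_x f x.
Proof.
move=> mf f0.
transitivity (\int[intensity_measure]_x f x).
  rewrite ge0_integral_measure_series//.
  by apply: eq_eseriesr => n _; rewrite ge0_integral_distribution.
pose iota : R -> measurableTypeR R := idfun.
have miota : measurable_fun setT iota by move=> _ Y mY; rewrite setTI.
pose m : {measure set (measurableTypeR R) -> \bar R} :=
  mscale (NngNum (ltW lambda_gt0)) (@lebesgue_measure R).
pose m1 : {measure set (measurableTypeR R) -> \bar R} :=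
  pushforward intensity_measure iota.
transitivity (\int[m1 miota]_x f x).
  by rewrite ge0_integral_pushforward.
rewrite (@eq_measure_integral _ _ _ _ m)/=; last first.
  by move=> A mA _; rewrite /m/= /mscale/= -intensity_measure_lebesgue.
by rewrite ge0_integral_mscale.
Qed.

End Campbell.

(** * Factorial moments and cumulants of order two *)

Lemma sum_le_esum (R : realType) (I : choiceType) (s : seq I) (a : I -> \bar R) :
  uniq s -> (forall i, 0 <= a i) -> \sum_(i <- s) a i <= \esum_(i in [set: I]) a i.
Proof.
move=> us a0; apply: esum_ge; exists [set` s].
  by split => //; exact: finite_seq.
by rewrite fsbig_seq.
Qed.

Lemma partition_ord2_1 (pi : {set {set 'I_2}}) :
  (finset.partition pi [set: 'I_2]%SET && (#|pi| == 1)%N) = (pi == [set [set: 'I_2]]%SET).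
Proof.
apply/andP/eqP => [[/and3P[/eqP cov _ _] /cards1P[A piA]]|->].
  by rewrite -cov piA cover1.
rewrite cards1 eqxx; split=> //; apply/and3P; split.
- by rewrite cover1 eqxx.
- exact: finset.trivIset1.
- by rewrite inE eq_sym -card_gt0 cardsT card_ord.
Qed.

Lemma ord2P (i : 'I_2) : i = ord0 \/ i = lift ord0 ord0.
Proof.
by case: i => [[|[|//]] ?]; [left|right]; exact/val_inj.
Qed.

Lemma partition_ord2_2 (pi : {set {set 'I_2}}) :
  (finset.partition pi [set: 'I_2]%SET && (#|pi| == 2)%N) =
  (pi == [set [set ord0]; [set lift ord0 ord0]]%SET).
Proof.
apply/andP/eqP => [[/and3P[/eqP cov tI n0] /cards2P[A [B [AB piE]]]]|->].
  move: cov tI n0; rewrite piE => cov tI n0.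
  have dAB x : x \in A -> (x \in B) = false.
    have AS : A \in [set A; B]%SET by rewrite !inE eqxx.
    have BS : B \in [set A; B]%SET by rewrite !inE eqxx orbT.
    by move/finset.trivIsetP : tI => /(_ _ _ AS BS AB)/disjointFr; apply.
  have A0 : A != finset.set0.
    by apply: contraNneq n0 => <-; rewrite !inE eqxx.
  have B0 : B != finset.set0.
    by apply: contraNneq n0 => <-; rewrite !inE eqxx orbT.
  have covE x : (x \in A) || (x \in B).
    have := finset.in_setT x; rewrite -cov => /finset.bigcupP[C].
    by rewrite !inE => /orP[]/eqP -> ->; rewrite ?orbT.
  have main (C D : {set 'I_2}) : (forall x, x \in C -> (x \in D) = false) ->
      D != finset.set0 -> (forall x, (x \in C) || (x \in D)) -> ord0 \in C ->
      C = [set ord0]%SET /\ D = [set lift ord0 ord0]%SET.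
    move=> dCD /set0Pn[x xD] cCD C0.
    have D0 := dCD _ C0.
    have D1 : lift ord0 ord0 \in D.
      by case: (ord2P x) xD => ->; rewrite ?D0.
    have C1 : (lift ord0 ord0 \in C) = false.
      by apply/negP => /dCD; rewrite D1.
    by split; apply/setP => y; rewrite inE; case: (ord2P y) => ->;
      rewrite ?eqxx ?C0 ?D1 ?D0 ?C1.
  have dBA x : x \in B -> (x \in A) = false.
    by move=> xB; apply/negP => /dAB; rewrite xB.
  case/orP: (covE ord0) => [/main|/main].
    by move=> /(_ _ dAB B0 covE)[-> ->].
  move=> /(_ _ dBA A0); case=> [x|-> ->]; first by rewrite orbC covE.
  by rewrite finset.setUC.
have ne : [set ord0]%SET != [set lift ord0 ord0]%SET :> {set 'I_2}.
  by apply/eqP => /setP/(_ ord0); rewrite !inE eqxx.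
rewrite cards2 ne; split=> //; apply/and3P; split.
- rewrite /finset.cover finset.bigcup_setU !big_set1; apply/eqP/setP => x.
  by rewrite !inE; case: (ord2P x) => ->.
- apply/finset.trivIsetP => A B; rewrite !inE => /orP[]/eqP-> /orP[]/eqP->;
    rewrite ?eqxx// => _; by rewrite disjoints1 inE.
- by rewrite !inE; apply/norP; split; rewrite eq_sym -card_gt0 cards1.
Qed.

Section SecondOrder.
Context {d : measure_display} {T : measurableType d} {R : realType}.
Variables (P : probability T R) (X : int -> {RV P >-> R}).

(** The blocks of a partition index factorial moments by types of the form
    [ 'I_#|K| ], to be identified with [ 'I_1 ] or [ 'I_2 ]. *)
Lemma factorial_moment_cast k k' (kk' : k = k') (B : 'I_k -> set R) (B' : 'I_k' -> set R) :
  (forall j, B j = B' (cast_ord kk' j)) ->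
  factorial_moment X B = factorial_moment X B'.
Proof.
subst k' => BB'; congr factorial_moment; apply/funext => j.
by rewrite BB' cast_ord_id.
Qed.

Lemma factorial_cumulant2 (B : 'I_2 -> set R) :
  factorial_cumulant X B =
  (fine (factorial_moment X B) -
   fine (factorial_moment X (fun _ : 'I_1 => B ord0)) *
   fine (factorial_moment X (fun _ : 'I_1 => B (lift ord0 ord0))))%R.
Proof.
rewrite /factorial_cumulant big_nat_recr//= big_nat1 expr0 expr1 !mul1r (_ : 1`! = 1%N)// mulr1 mulN1r.
congr (_ - _)%R.
  rewrite (eq_bigl _ _ partition_ord2_1) big_pred1_eq big_set1; congr fine.
  have c2 : #|[set: 'I_2]%SET| = 2%N by rewrite cardsT card_ord.
  apply: (factorial_moment_cast (kk' := c2)) => j; congr B.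
  apply: val_inj => /=.
  rewrite (enum_val_nth ord0) enum_setT -enumT /= nth_enum_ord//.
  by rewrite -[X in (_ < X)%N]c2.
rewrite (eq_bigl _ _ partition_ord2_2) big_pred1_eq.
have ne : [set ord0]%SET != [set lift ord0 ord0]%SET :> {set 'I_2}.
  by apply/eqP => /setP/(_ ord0); rewrite !inE eqxx.
rewrite big_setU1/= ?inE// big_set1.
have E (x : 'I_2) : factorial_moment X (fun j : 'I_#|[set x]%SET| => B (enum_val j)) =
    factorial_moment X (fun _ : 'I_1 => B x).
  apply: (factorial_moment_cast (kk' := cards1 x)) => j; congr B.
  by have := enum_valP j; rewrite inE => /eqP.
by rewrite !E.
Qed.

Lemma factorial_moment1 (B : set R) :
  factorial_moment X (fun _ : 'I_1 => B) = \int[P]_w Psi X w B.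
Proof.
apply: eq_integral => w _.
rewrite (@reindex_esum _ _ _ [set: int] _ (fun n => [ffun=> n])).
  by apply: eq_esum => i _; rewrite big_ord1 ffunE.
split=> [i _ /=|i j _ _ /ffunP/(_ ord0)|f _].
- by move=> x y _; rewrite !ord1.
- by rewrite !ffunE.
- by exists (f ord0) => //; apply/ffunP => x; rewrite ffunE (ord1 x).
Qed.

(** Number of ordered pairs of distinct indices whose points lie in [B0] and
    [B1] respectively. *)
Definition pair_sum (B0 B1 : set R) w : \bar R :=
  \esum_(i in [set: int]) \esum_(j in [set j | j != i])
    (\1_B0 (X i w) * \1_B1 (X j w))%:E.

Lemma factorial_moment2 (B : 'I_2 -> set R) :
  factorial_moment X B =
  \int[P]_w pair_sum (B ord0) (B (lift ord0 ord0)) w.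
Proof.
apply: eq_integral => w _; rewrite /pair_sum esum_esum//.
rewrite (@reindex_esum _ _ _ ([set: int] `*`` (fun i => [set j | j != i])) _ (fun p : int * int =>
    [ffun j : 'I_2 => if j == ord0 then p.1 else p.2])).
  by apply: eq_esum => -[i j] _; rewrite big_ord_recl big_ord1 !ffunE.
split=> [[i j] /= [_ ji]|[i j] [i' j'] _ _ /ffunP E|f /= fi].
- move=> x y; rewrite !ffunE; case: (ord2P x) => ->; case: (ord2P y) => -> //=.
    by move=> h; move: ji; rewrite h eqxx.
  by move=> h; move: ji; rewrite h eqxx.
- by have := E ord0; have := E (lift ord0 ord0); rewrite !ffunE/= => -> ->.
- exists (f ord0, f (lift ord0 ord0)).
    by split => //=; apply/eqP => /fi.
  by apply/ffunP => x; rewrite ffunE; case: (ord2P x) => ->.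
Qed.

End SecondOrder.

Lemma measurable_nneseries d (T : measurableType d) (R : realType)
    (h : nat -> T -> \bar R) : (forall k x, 0 <= h k x) ->
  (forall k, measurable_fun setT (h k)) ->
  measurable_fun setT (fun x => \sum_(i <oo) h i x).
Proof. by move=> h0 mh; apply: ge0_emeasurable_sum => // k _; exact: mh. Qed.

Lemma lee_sqrD (R : realType) (x y : \bar R) : 0 <= x -> 0 <= y ->
  (x + y) * (x + y) <= 2%:E * (x * x) + 2%:E * (y * y).
Proof.
case: x => [x| |]; case: y => [y| |] // x0 y0.
- rewrite -EFinD -!EFinM -EFinD lee_fin; have : (0 <= (x - y) ^+ 2)%R by exact: sqr_ge0.
  nra.
- by rewrite mulyy gt0_muley// addey// leey.
- by rewrite mulyy gt0_muley// addye// leey.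
- by rewrite mulyy gt0_muley// addye// leey.
Qed.

Section SecondMoment.
Context {d : measure_display} {T : measurableType d} {R : realType}.
Variables (P : probability T R) (X : int -> {RV P >-> R}).
Variable e : nat -> int.
Hypothesis e_bij : set_bij [set: nat] [set: int] e.

Lemma esum_int_series (a : int -> \bar R) : (forall i, 0 <= a i) ->
  \esum_(i in [set: int]) a i = \sum_(n <oo) a (e n).
Proof.
by move=> a0; rewrite (@reindex_esum _ _ _ _ _ _ _ e_bij) nneseries_esumT.
Qed.

Lemma esum_intZl (c : R) (a : int -> \bar R) : (forall i, 0 <= a i) -> (0 <= c)%R ->
  \esum_(i in [set: int]) (c%:E * a i) = c%:E * \esum_(i in [set: int]) a i.
Proof.
move=> a0 c0; rewrite !esum_int_series ?nneseriesZl// => i.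
by rewrite mule_ge0.
Qed.

Lemma le_Psi w (A B : set R) : A `<=` B -> Psi X w A <= Psi X w B.
Proof.
move=> AB; apply: le_esum => i _; rewrite !diracE lee_fin ler_nat.
by case: (boolP (_ \in A)) => // /set_mem/AB/mem_set ->.
Qed.

Lemma Psi_setU w (A B : set R) : Psi X w (A `|` B) <= Psi X w A + Psi X w B.
Proof.
rewrite /Psi -esumD//; apply: le_esum => i _.
rewrite !diracE -EFinD lee_fin in_setU -natrD ler_nat.
by case: (_ \in A); case: (_ \in B).
Qed.

Lemma pair_sum_mkcond B0 B1 w : pair_sum X B0 B1 w =
  \sum_(n <oo) \sum_(m <oo)
    (if e m != e n then (\1_B0 (X (e n) w) * \1_B1 (X (e m) w))%:E else 0).
Proof.
rewrite /pair_sum esum_int_series; last first.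
  by move=> i; apply: esum_ge0 => j _; rewrite lee_fin mulr_ge0.
apply: eq_eseriesr => n _.
rewrite esum_mkcond esum_int_series; last first.
  by move=> j; case: ifPn => // _; rewrite lee_fin mulr_ge0.
apply: eq_eseriesr => m _.
by congr (if _ then _ else _); apply/idP/idP; rewrite inE.
Qed.

Lemma measurable_pair_sum B0 B1 : measurable B0 -> measurable B1 ->
  measurable_fun setT (pair_sum X B0 B1).
Proof.
move=> mB0 mB1; rewrite (funext (pair_sum_mkcond B0 B1)).
have t0 n m w : 0 <= (if e m != e n then
    (\1_B0 (X (e n) w) * \1_B1 (X (e m) w))%:E else 0%E : \bar R).
  by case: ifPn => // _; rewrite lee_fin mulr_ge0.
apply: measurable_nneseries; first by move=> n w; apply: nneseries_ge0 => m _ _; exact: t0.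
move=> n; apply: measurable_nneseries; first by move=> m w; exact: t0.
move=> m.
case: (e m != e n); last exact: measurable_cst.
apply/measurable_EFinP/measurable_funM.
  by apply: measurableT_comp => //; exact: measurable_indic.
by apply: measurableT_comp => //; exact: measurable_indic.
Qed.

Lemma pair_sum_le B0 B1 w : pair_sum X B0 B1 w <= Psi X w B0 * Psi X w B1.
Proof.
pose c i : R := \1_B0 (X i w).
have c0 i : (0 <= c i)%R by [].
have PB0 : Psi X w B0 = \esum_(i in [set: int]) (c i)%:E.
  by apply: eq_esum.
apply: (@le_trans _ _ (\esum_(i in [set: int]) ((c i)%:E * Psi X w B1))).
  apply: le_esum => i _; rewrite /Psi -esum_intZl// esum_mkcond.
  apply: le_esum => j _; case: ifPn => // _.
  by rewrite mule_ge0// lee_fin.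
have := Psi_ge0 X w B1; case: (Psi X w B1) => [y| |] // y0.
  by under eq_esum do rewrite muleC; rewrite esum_intZl// muleC PB0.
have [c00|] := pselect (forall i, c i = 0%R).
  rewrite esum1 ?mule_ge0// ?Psi_ge0// => i _.
  by rewrite c00 mul0e.
move/existsNP => [i ci0]; rewrite gt0_muley ?leey// PB0.
rewrite lt_neqAle esum_ge0 ?andbT//; last by move=> j _; rewrite lee_fin.
apply/eqP => h; apply: ci0; apply/eqP; rewrite eq_le c0 andbT -lee_fin.
have := @sum_le_esum R int [:: i] (fun i => (c i)%:E) isT (fun=> c0 _).
by rewrite big_seq1 -h.
Qed.

Lemma sum_prob_le_factorial_moment (s : seq int) B0 B1 :
  uniq s -> measurable B0 -> measurable B1 ->
  \sum_(i <- s) \sum_(j <- s | j != i) P (X i @^-1` B0 `&` X j @^-1` B1) <=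
  \int[P]_w pair_sum X B0 B1 w.
Proof.
move=> us mB0 mB1.
pose f i j w : \bar R :=
  if j != i then (\1_B0 (X i w) * \1_B1 (X j w))%:E else 0%E.
have f0 i j w : 0 <= f i j w by rewrite /f; case: ifP => // _; rewrite lee_fin mulr_ge0.
have mf i j : measurable_fun setT (f i j).
  rewrite /f; case: (j != i); last exact: measurable_cst.
  apply/measurable_EFinP/measurable_funM.
    by apply: measurableT_comp => //; exact: measurable_indic.
  by apply: measurableT_comp => //; exact: measurable_indic.
have Pf i j : (if j != i then P (X i @^-1` B0 `&` X j @^-1` B1) else 0) =
    \int[P]_w f i j w.
  rewrite /f; case: (j != i); last by rewrite integral0.
  have m0 : measurable (X i @^-1` B0) by rewrite -[X in measurable X]setTI; exact: measurable_funP.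
  have m1 : measurable (X j @^-1` B1) by rewrite -[X in measurable X]setTI; exact: measurable_funP.
  have m01 := measurableI _ _ m0 m1.
  have := integral_indic P measurableT m01; rewrite setIT => <-.
  apply: eq_integral => w _; rewrite !indicE in_setI -natrM mulnb.
  by congr (nat_of_bool (_ && _))%:R%:E; apply/idP/idP; rewrite !inE.
have mS i : measurable_fun setT (fun w => \sum_(j <- s) f i j w).
  exact: emeasurable_sum.
rewrite (eq_bigr (fun i => \int[P]_w \sum_(j <- s) f i j w)); last first.
  move=> i _; rewrite big_mkcond/= ge0_integral_sum//.
  by apply: eq_bigr => j _; exact: Pf.
rewrite -ge0_integral_sum//; last by move=> i w _; exact: sume_ge0.
apply: ge0_le_integral => //.
- by move=> w _; apply: sume_ge0 => i _; exact: sume_ge0.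
- exact: emeasurable_sum.
- exact: measurable_pair_sum.
move=> w _; rewrite /pair_sum.
apply: le_trans (sum_le_esum us _); last first.
  by move=> i; apply: esum_ge0 => j _; rewrite lee_fin mulr_ge0.
apply: lee_sum => i _; rewrite esum_mkcond.
apply: le_trans (sum_le_esum us _); last first.
  by move=> j; case: ifP => // _; rewrite lee_fin mulr_ge0.
apply: lee_sum => j _; rewrite /f.
case: ifPn => ji; first by rewrite ifT// inE.
by case: ifP => // _; rewrite lee_fin mulr_ge0.
Qed.

End SecondMoment.

Section SecondOrderBound.
Context {d : measure_display} {T : measurableType d} {R : realType}.
Variables (P : probability T R) (X : int -> {RV P >-> R}).
Variable e : nat -> int.
Hypothesis e_bij : set_bij [set: nat] [set: int] e.
Hypothesis X_locally_finite : locally_finite_process X.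
Hypothesis X_stationary : stationary_process X.
Variable lambda : R.
Hypothesis X_intensity : intensity X = lambda%:E.
Hypothesis lambda_gt0 : (0 < lambda)%R.
Hypothesis Psi2 : \int[P]_w (Psi X w `[0%R, 1%R] ^+ 2) < +oo.

Lemma integral_Psi_sqr_unit (a : R) :
  \int[P]_w (Psi X w `[a, (a + 1)%R] * Psi X w `[a, (a + 1)%R]) < +oo.
Proof.
pose g (y : \bar R) := y * y.
have mg : measurable_fun setT g by apply: emeasurable_funM; exact: measurable_id.
have g0 y : 0 <= y -> 0 <= g y by move=> y0; rewrite /g mule_ge0.
have := integral_Psi_shift e_bij X_locally_finite X_stationary a
  (bounded_Borel_itv true false 0%R 1%R) mg g0.
rewrite (_ : shift_set _ a = `[a, (a + 1)%R]%classic); last first.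
  rewrite shift_setE; apply/seteqP; split => x /=;
  rewrite !in_itv/= => /andP[? ?]; apply/andP; split; lra.
rewrite /g => ->.
by under eq_integral do rewrite -expe2.
Qed.

Lemma measurable_Psi_sqr B : measurable B ->
  measurable_fun setT (fun w => Psi X w B * Psi X w B).
Proof.
move=> mB; have h := measurable_Psi X e_bij mB.
by apply: emeasurable_funM.
Qed.

Lemma integral_Psi_sqr_itv (a : R) n :
  \int[P]_w (Psi X w `[a, (a + n%:R)%R] * Psi X w `[a, (a + n%:R)%R]) < +oo.
Proof.
elim: n => [|n IH].
  apply: le_lt_trans (integral_Psi_sqr_unit a).
  apply: ge0_le_integral => //.
  - by move=> w _; rewrite mule_ge0// Psi_ge0.
  - exact: measurable_Psi_sqr.
  - exact: measurable_Psi_sqr.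
  move=> w _; apply: lee_pmul; rewrite ?Psi_ge0//; apply: le_Psi;
    by apply: subset_itvl; rewrite bnd_simp addr0 lerDl.
pose A := `[a, (a + n%:R)%R]%classic.
pose B := `[(a + n%:R)%R, (a + n%:R + 1)%R]%classic.
have h2 w C : 0 <= 2%:E * (Psi X w C * Psi X w C).
  by rewrite mule_ge0// mule_ge0// Psi_ge0.
have mh2 C : measurable C ->
    measurable_fun setT (fun w => 2%:E * (Psi X w C * Psi X w C)).
  move=> mC; apply: emeasurable_funM; first exact: measurable_cst.
  exact: measurable_Psi_sqr.
apply: (@le_lt_trans _ _ (\int[P]_w
   (2%:E * (Psi X w A * Psi X w A) + 2%:E * (Psi X w B * Psi X w B)))).
  apply: ge0_le_integral => //.
  - by move=> w _; rewrite mule_ge0// Psi_ge0.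
  - exact: measurable_Psi_sqr.
  - by apply: emeasurable_funD; apply: mh2; exact: measurable_itv.
  move=> w _; apply: le_trans (lee_sqrD (Psi_ge0 _ _ _) (Psi_ge0 _ _ _)).
  have : Psi X w `[a, (a + n.+1%:R)%R] <= Psi X w A + Psi X w B.
    apply: le_trans (Psi_setU _ _ _ _); apply: le_Psi => x /=.
    rewrite !in_itv/= -natr1 => /andP[ax xn].
    have [?|/ltW ?] := leP x (a + n%:R)%R; [left|right].
      by rewrite /A /= in_itv/= ax.
    by rewrite /B /= in_itv/=; apply/andP; split => //; rewrite addrA in xn.
  by move=> h; apply: lee_pmul; rewrite ?Psi_ge0.
rewrite ge0_integralD//; [|by apply: mh2; exact: measurable_itv..].
rewrite !ge0_integralZl//; last 4 first.
- by apply: measurable_Psi_sqr; exact: measurable_itv.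
- by move=> w _; rewrite mule_ge0// Psi_ge0.
- by apply: measurable_Psi_sqr; exact: measurable_itv.
- by move=> w _; rewrite mule_ge0// Psi_ge0.
apply: lte_add_pinfty.
  by apply: lte_mul_pinfty; [rewrite lee_fin ler0n| |exact: IH].
by apply: lte_mul_pinfty; [rewrite lee_fin ler0n| |exact: integral_Psi_sqr_unit].
Qed.

Lemma bounded_Borel_sub_itv (B : set R) : bounded_Borel B ->
  exists (a : R) (n : nat), B `<=` `[a, (a + n%:R)%R].
Proof.
move=> [_ [M [_ hM]]].
pose n := (Num.truncn `|M|).+1.
have hn : (`|M| < n%:R)%R by exact: truncnS_gt.
exists (- n%:R)%R, (n + n)%N => x Bx /=.
have := hM n%:R (le_lt_trans (ler_norm M) hn) _ Bx.
rewrite /= ler_norml in_itv/= natrD => /andP[? ?]; apply/andP; split => //.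
lra.
Qed.

(** Finiteness makes the use of [fine] in the definition of the cumulant
    harmless. *)
Lemma factorial_moment2_fin B0 B1 : bounded_Borel B0 -> bounded_Borel B1 ->
  \int[P]_w pair_sum X B0 B1 w < +oo.
Proof.
move=> bB0 bB1; have [mB0 [M0 [_ hM0]]] := bB0; have [mB1 [M1 [_ hM1]]] := bB1.
have : bounded_Borel (B0 `|` B1).
  split; first exact: measurableU.
  exists (`|M0| + `|M1|)%R; split; first exact: num_real.
  move=> M hM x [B0x|B1x].
    apply: hM0 B0x; apply: le_lt_trans hM; apply: (le_trans (ler_norm _)).
    by rewrite lerDl.
  apply: hM1 B1x; apply: le_lt_trans hM; apply: (le_trans (ler_norm _)).
  by rewrite lerDr.
move=> /bounded_Borel_sub_itv[a [n h]].
apply: le_lt_trans (integral_Psi_sqr_itv a n).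
apply: ge0_le_integral => //.
- move=> w _; apply: esum_ge0 => i _; apply: esum_ge0 => j _.
  by rewrite lee_fin mulr_ge0.
- exact: (measurable_pair_sum X e_bij).
- by apply: measurable_Psi_sqr; exact: measurable_itv.
move=> w _; apply: le_trans (pair_sum_le X e_bij _ _ _) _.
apply: lee_pmul; rewrite ?Psi_ge0//; apply: le_Psi; apply: subset_trans h.
  exact: subsetUl.
exact: subsetUr.
Qed.

Lemma factorial_moment1E B : measurable B ->
  factorial_moment X (fun _ : 'I_1 => B) = lambda%:E * lebesgue_measure B.
Proof.
move=> mB; rewrite factorial_moment1 -(intensity_measureE X e_bij)//.
exact: (intensity_measure_lebesgue e_bij).
Qed.

Lemma bounded_Borel_lebesgue B : bounded_Borel B -> @lebesgue_measure R B < +oo.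
Proof.
move=> bB; have [a [n h]] := bounded_Borel_sub_itv bB; have [mB _] := bB.
apply: (@le_lt_trans _ _ (lebesgue_measure `[a, (a + n%:R)%R]%classic)).
  by apply: le_measure; rewrite ?inE//; exact: measurable_itv.
by rewrite lebesgue_measure_itv/=; case: ifP => // _; rewrite ltry.
Qed.

(** A finite measure on 1-tuples, viewed as a measure on the line. *)
Lemma tuple1_marginal (m : {measure set (1.-tuple R) -> \bar R}) : m setT < +oo ->
  exists m1 : {sigma_finite_measure set R -> \bar R},
    (forall B, m1 B = m [set t | B (tnth t ord0)]) /\ m1 setT < +oo.
Proof.
move=> mfin; pose phi (t : 1.-tuple R) := tnth t ord0.
have mphi : measurable_fun setT phi by exact: measurable_tnth.
pose m' : {measure set R -> \bar R} := pushforward m phi.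
have fin : m' mphi setT < +oo by rewrite /m' /= /pushforward preimage_setT.
have [|m1 m1E] := @sigma_finite_pack _ _ _ (m' mphi).
  exists (fun=> setT); first by rewrite bigcup_const//; exists 0%N.
  by move=> _; split.
by exists m1; split=> [B|]; rewrite m1E.
Qed.

(** The measure under [m] of the translate of [B] by [- p]. *)
Definition shift_kernel (m : set R -> \bar R) (B : set R) (p : R) : \bar R :=
  m [set t | B (t + p)%R].

Lemma measurable_shift_kernel (m : {sigma_finite_measure set R -> \bar R}) B :
  measurable B -> measurable_fun setT (shift_kernel m B).
Proof.
move=> mB; pose C : set (R * R) := [set z | B (z.2 + z.1)%R].
have mC : measurable C.
  rewrite -[X in measurable X]setTI.
  by apply: (measurable_funD measurable_snd measurable_fst).
have -> : shift_kernel m B = m \o xsection C.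
  apply/funext => p; rewrite /shift_kernel /=; congr (m _).
  by apply/seteqP; split => t; rewrite /xsection/= inE.
exact: measurable_fun_xsection.
Qed.

Variable nu : signed_measure R 1.
Hypothesis nu_red : reduced_cumulant X nu.
Hypothesis nu_tv : total_variation nu < +oo.
Variable nu1 : {sigma_finite_measure set R -> \bar R}.
Hypothesis nu1E : forall B, nu1 B = sm_pos nu [set t | B (tnth t ord0)].

(** Dropping the negative part of the reduced covariance measure. *)
Lemma factorial_cumulant_le B0 B1 (B : 'I_2 -> set R) :
  B ord0 = B0 -> B (lift ord0 ord0) = B1 ->
  bounded_Borel B0 -> bounded_Borel B1 ->
  (factorial_cumulant X B)%:E <=
  lambda%:E * \int[lebesgue_measure]_(p in B0) shift_kernel nu1 B1 p.
Proof.
move=> BB0 BB1 bB0 bB1; rewrite (nu_red (B := B)); last first.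
  by move=> i; case: (ord2P i) => ->; rewrite ?BB0 ?BB1.
rewrite X_intensity lee_pmul2l ?lte_fin// BB0.
have [mB0 _] := bB0; have [mB1 _] := bB1.
have negfin : sm_neg nu setT < +oo.
  by apply: le_lt_trans nu_tv; rewrite /total_variation leeDr.
have [nu2 [nu2E nu2fin]] := tuple1_marginal negfin.
pose f p := shift_kernel nu1 B1 p - shift_kernel nu2 B1 p.
have fE p : sm_val nu [set t | forall i : 'I_1, B (lift ord0 i) (tnth t i + p)%R] = f p.
  rewrite /sm_val /f /shift_kernel nu1E nu2E.
  have -> : [set t : 1.-tuple R | forall i : 'I_1, B (lift ord0 i) (tnth t i + p)%R] =
      [set t | [set t | B1 (t + p)%R] (tnth t ord0)].
    apply/seteqP; split => t /=; first by move/(_ ord0); rewrite BB1.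
    by move=> h i; rewrite (ord1 i) BB1.
  by [].
under eq_integral do rewrite fE.
have mf : measurable_fun setT f.
  by apply: emeasurable_funB; exact: measurable_shift_kernel.
rewrite integralE; apply: (@le_trans _ _ (\int[lebesgue_measure]_(p in B0) f^\+ p)).
  by rewrite -[leRHS]sube0 leeB// integral_ge0.
apply: ge0_le_integral => //.
- by apply: measurable_funepos; exact: measurable_funS mf.
- by apply: (measurable_funS measurableT) => //; exact: measurable_shift_kernel.
move=> p _; rewrite funeposE /f ge_max measure_ge0 andbT.
by rewrite -[leRHS]sube0 leeB.
Qed.

(** The expected number of pairs of distinct points in [B0] and [B1] exceeds
    the product of the two expected numbers of points by at most a term given
    by the positive part [nu1] of the reduced covariance measure.  This is the
    only consequence of Brillinger-mixing that is used. *)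
Lemma second_order_bound (s : seq int) B0 B1 : uniq s ->
  bounded_Borel B0 -> bounded_Borel B1 ->
  \sum_(i <- s) \sum_(j <- s | j != i) P (X i @^-1` B0 `&` X j @^-1` B1) <=
  (lambda%:E * lebesgue_measure B0) * (lambda%:E * lebesgue_measure B1) +
  lambda%:E * \int[lebesgue_measure]_(p in B0) shift_kernel nu1 B1 p.
Proof.
move=> us bB0 bB1; have [mB0 _] := bB0; have [mB1 _] := bB1.
apply: le_trans (sum_prob_le_factorial_moment X e_bij us mB0 mB1) _.
pose B (i : 'I_2) := if i == ord0 then B0 else B1.
have := factorial_cumulant_le (B := B) erefl erefl bB0 bB1.
rewrite factorial_cumulant2.
have fin C : bounded_Borel C -> lambda%:E * lebesgue_measure C \is a fin_num.
  move=> bC; have l0 : 0 <= lambda%:E by rewrite lee_fin ltW.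
  by rewrite ge0_fin_numE ?mule_ge0// lte_mul_pinfty// bounded_Borel_lebesgue.
have fin0 := fin _ bB0; have fin1 := fin _ bB1.
rewrite !factorial_moment1E// EFinB EFinM !fineK//; last first.
  rewrite ge0_fin_numE; first by rewrite factorial_moment2 factorial_moment2_fin.
  rewrite factorial_moment2 integral_ge0// => w _.
  by apply: esum_ge0 => i _; apply: esum_ge0 => j _; rewrite lee_fin mulr_ge0.
rewrite factorial_moment2 /= => h.
by rewrite addeC -leeBlDr// fin_numM.
Qed.

End SecondOrderBound.

(** * First and second moment of a mark-averaged sum *)

Section ProductSigmaFinite.
Context d1 d2 (T1 : measurableType d1) (T2 : measurableType d2) (R : realType).

Lemma sigma_finite_product (m1 : {sigma_finite_measure set T1 -> \bar R})
    (m2 : {sigma_finite_measure set T2 -> \bar R}) : m2 setT < +oo ->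
  sigma_finite setT (m1 \x m2).
Proof.
move=> m2fin; have [F FT Ffin] := sigma_finiteT m1.
exists (fun n => F n `*` setT); first by rewrite -setX_bigcupl -FT setXTT.
move=> n; have [mF Fn] := Ffin n; split; first exact: measurableX.
by rewrite product_measure1E// lte_mul_pinfty// ge0_fin_numE.
Qed.

Variables (m1 : {measure set T1 -> \bar R}) (m2 : {measure set T2 -> \bar R}).
Hypothesis (sf1 : sigma_finite setT m1) (sf2 : sigma_finite setT m2).

Lemma sigma_finite_measurable_xsection (A : set (T1 * T2)) : measurable A ->
  measurable_fun setT (fun x => m2 (xsection A x)).
Proof.
move=> mA; have [m2' m2'E] := sigma_finite_pack sf2.
rewrite (_ : (fun x => _) = m2' \o xsection A); last by apply/funext => x /=; rewrite m2'E.
exact: measurable_fun_xsection.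
Qed.

Lemma sigma_finite_tonelli_sections (A : set (T1 * T2)) : measurable A ->
  \int[m1]_x m2 (xsection A x) = \int[m2]_y m1 (ysection A y).
Proof.
move=> mA; have [m1' m1'E] := sigma_finite_pack sf1.
have [m2' m2'E] := sigma_finite_pack sf2.
rewrite (@eq_measure_integral _ _ _ _ m1'); last by move=> B _ _; exact/esym/m1'E.
rewrite [RHS](@eq_measure_integral _ _ _ _ m2'); last by move=> B _ _; exact/esym/m2'E.
under eq_integral do rewrite -m2'E.
under [RHS]eq_integral do rewrite -m1'E.
exact: (tonelli_sections m1' m2' mA).
Qed.

End ProductSigmaFinite.

(** The function [w p], the probability that a point at [p] receives a mark
    [m] with [(p, m)] in [J], is a mixture of the indicators of the bounded
    sections of [J].  Moments of the sum of the [w (X i)] therefore reduce to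
    moments of the point process on bounded sets. *)
Section MarkedSecondMoment.
Context {d : measure_display} {T : measurableType d} {R : realType}.
Variables (P : probability T R) (X : int -> {RV P >-> R}).
Context {d2 : measure_display} {S : measurableType d2}.
Variable mu : probability S R.
Variable e : nat -> int.
Hypothesis e_bij : set_bij [set: nat] [set: int] e.
Variable lambda : R.
Hypothesis lambda_gt0 : (0 < lambda)%R.
Hypothesis X_Campbell : forall f : R -> \bar R, measurable_fun setT f ->
  (forall x, 0 <= f x) ->
  \sum_(n <oo) \int[P]_w f (X (e n) w) = lambda%:E * \int[lebesgue_measure]_x f x.
Variable nu1 : {sigma_finite_measure set R -> \bar R}.
Variable kappa : R.
Hypothesis nu1_kappa : nu1 setT = kappa%:E.
Hypothesis X_second_order : forall (s : seq int) B0 B1, uniq s ->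
  bounded_Borel B0 -> bounded_Borel B1 ->
  \sum_(i <- s) \sum_(j <- s | j != i) P (X i @^-1` B0 `&` X j @^-1` B1) <=
  (lambda%:E * lebesgue_measure B0) * (lambda%:E * lebesgue_measure B1) +
  lambda%:E * \int[lebesgue_measure]_(p in B0) shift_kernel nu1 B1 p.

Variable J : set (R * S).
Hypothesis mJ : measurable J.
Hypothesis bJ : forall m, bounded_set (ysection J m).
Variable a : R.
Hypothesis aE : \int[mu]_m lebesgue_measure (ysection J m) = a%:E.
Variable s : R.
Hypothesis sE : forall p, (section_prob mu J p <= s)%R.

Let L : {sigma_finite_measure set (measurableTypeR R) -> \bar R} := @lebesgue_measure R.
Let w := section_prob mu J.

Let w0 p : (0 <= w p)%R. Proof. exact: section_prob_ge0. Qed.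
Let s0 : (0 <= s)%R. Proof. exact: le_trans (w0 0%R) (sE _). Qed.
Let mw : measurable_fun setT w. Proof. exact: measurable_section_prob. Qed.
Let wE p : (w p)%:E = mu (xsection J p). Proof. exact: section_probE. Qed.
Let mwX i : measurable_fun setT (fun t => w (X i t)).
Proof. exact: measurableT_comp. Qed.

Lemma integral_section_prob : \int[lebesgue_measure]_p (w p)%:E = a%:E.
Proof.
rewrite -aE; under eq_integral do rewrite wE.
exact: (tonelli_sections L mu mJ).
Qed.

Lemma sum_section_prob : \sum_(n <oo) \int[P]_t (w (X (e n) t))%:E = (lambda * a)%:E.
Proof.
rewrite (X_Campbell (f := fun p => (w p)%:E)).
- by rewrite integral_section_prob.
- exact/measurable_EFinP.
- by move=> x; rewrite lee_fin.
Qed.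

Lemma sum_section_prob_le (q : seq int) : uniq q ->
  \sum_(i <- q) \int[P]_t (w (X i t))%:E <= (lambda * a)%:E.
Proof.
move=> uq; rewrite -sum_section_prob.
have i0 i : 0 <= \int[P]_t (w (X i t))%:E.
  by apply: integral_ge0 => t _; rewrite lee_fin.
by rewrite -(esum_int_series e_bij i0); exact: sum_le_esum.
Qed.

Let sfL : sigma_finite setT (L \x nu1).
Proof. by apply: sigma_finite_product; rewrite nu1_kappa ltry. Qed.

Let sfmu : sigma_finite setT (mu \x mu).
Proof. apply: sigma_finite_product; exact: le_lt_trans (probability_le1 mu measurableT) (ltry _). Qed.

Let sfP : sigma_finite setT P.
Proof. exact: sigma_finiteT. Qed.

Let bBJ m : bounded_Borel (ysection J m).
Proof. by split; [exact: measurable_ysection|exact: bJ]. Qed.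

(** Outcomes and pairs of marks putting both points [i] and [j] in [J]. *)
Let prod_pair i j : set (T * (S * S)) :=
  [set z | J (X i z.1, z.2.1) /\ J (X j z.1, z.2.2)].

Let mprod_pair i j : measurable (prod_pair i j).
Proof.
apply: measurableI.
  rewrite -[X in measurable X]setTI.
  apply: (measurable_fun_pair (f := fun z => X i z.1) (g := fun z : T * (S * S) => z.2.1)) => //.
    by apply: measurableT_comp => //; exact: measurable_fst.
  by apply: (measurableT_comp measurable_fst measurable_snd).
rewrite -[X in measurable X]setTI.
apply: (measurable_fun_pair (f := fun z => X j z.1) (g := fun z : T * (S * S) => z.2.2)) => //.
  by apply: measurableT_comp => //; exact: measurable_fst.
by apply: (measurableT_comp measurable_snd measurable_snd).
Qed.

Lemma integral_section_prob_pair i j :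
  \int[P]_t (w (X i t) * w (X j t))%:E =
  \int[mu \x mu]_z P (X i @^-1` ysection J z.1 `&` X j @^-1` ysection J z.2).
Proof.
transitivity (\int[P]_t (mu \x mu)%E (xsection (prod_pair i j) t)).
  apply: eq_integral => t _.
  have -> : xsection (prod_pair i j) t = xsection J (X i t) `*` xsection J (X j t).
    by apply/seteqP; split => -[m m']; rewrite /xsection/= !inE.
  rewrite product_measure1E ?EFinM ?wE//; exact: measurable_xsection.
rewrite (sigma_finite_tonelli_sections sfP sfmu (mprod_pair i j)).
apply: eq_integral => -[m m'] _; congr (P _).
by apply/seteqP; split => t; rewrite /ysection/= !inE.
Qed.

(** Pairs of marks and pairs of a position [p] and a displacement [t] such
    that [p] and [t + p] are both hit. *)
Let quad : set ((S * S) * (measurableTypeR R * R)) :=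
  [set z | J (z.2.1, z.1.1) /\ J ((z.2.2 + z.2.1)%R, z.1.2)].

Let mquad : measurable quad.
Proof.
have m21 : measurable_fun setT (fun z : (S * S) * (R * R) => z.2.1).
  exact: (measurableT_comp measurable_fst measurable_snd).
have m22 : measurable_fun setT (fun z : (S * S) * (R * R) => z.2.2).
  exact: (measurableT_comp measurable_snd measurable_snd).
have m11 : measurable_fun setT (fun z : (S * S) * (R * R) => z.1.1).
  exact: (measurableT_comp measurable_fst measurable_fst).
have m12 : measurable_fun setT (fun z : (S * S) * (R * R) => z.1.2).
  exact: (measurableT_comp measurable_snd measurable_fst).
apply: measurableI.
  by rewrite -[X in measurable X]setTI; exact: (measurable_fun_pair m21 m11).
rewrite -[X in measurable X]setTI.
exact: (measurable_fun_pair (measurable_funD m22 m21) m12).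
Qed.

Let quadE m m' : (L \x nu1)%E (xsection quad (m, m')) =
  \int[lebesgue_measure]_(p in ysection J m) shift_kernel nu1 (ysection J m') p.
Proof.
rewrite [RHS]integral_mkcond; apply: eq_integral => p _.
rewrite patchE; case: ifPn => pJ.
  rewrite /shift_kernel /=; congr (nu1 _); apply/seteqP.
  split => t; rewrite /xsection /ysection /= !inE /quad /= ?inE.
    by move=> [].
  by move=> h; split => //; move: pJ; rewrite inE => /ysectionP.
rewrite /= (_ : xsection _ p = set0) ?measure0//.
apply/seteqP; split => t //; move=> /xsectionP /xsectionP [/= h _].
by move: pJ; rewrite notin_setE; case; apply/ysectionP.
Qed.

Lemma integral_quad :
  \int[mu \x mu]_z (L \x nu1)%E (xsection quad z) <= (a * s * kappa)%:E.
Proof.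
rewrite (sigma_finite_tonelli_sections sfmu sfL mquad).
have E (z : measurableTypeR R * R) : (mu \x mu)%E (ysection quad z) = (w z.1)%:E * (w (z.2 + z.1))%:E.
  have -> : ysection quad z = xsection J z.1 `*` xsection J (z.2 + z.1)%R.
    by apply/seteqP; split => -[m m']; rewrite /xsection /ysection /= !inE.
  by rewrite product_measure1E ?wE//; exact: measurable_xsection.
rewrite (eq_integral (fun z : measurableTypeR R * R =>
  (w z.1)%:E * (w (z.2 + z.1))%:E)); last by move=> z _; exact: E.
pose f (z : measurableTypeR R * R) := s%:E * (w z.1)%:E.
have mf : measurable_fun setT f.
  apply: emeasurable_funM; first exact: measurable_cst.
  apply/measurable_EFinP; exact: (measurableT_comp mw measurable_fst).
have f0 z : 0 <= f z by rewrite mule_ge0 ?lee_fin.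
apply: (@le_trans _ _ (\int[L \x nu1]_z f z)).
  apply: ge0_le_integral => //.
  - by move=> z _; rewrite mule_ge0 ?lee_fin.
  - apply: emeasurable_funM; apply/measurable_EFinP.
      exact: (measurableT_comp mw measurable_fst).
    apply: (measurableT_comp mw).
    exact: (measurable_funD measurable_snd measurable_fst).
  - by move=> z _; rewrite /f muleC lee_pmul// ?lee_fin.
rewrite fubini_tonelli1// /fubini_F /=.
have kappa0 : (0 <= kappa)%R by rewrite -lee_fin -nu1_kappa.
rewrite (eq_integral (fun x : measurableTypeR R => (s * kappa)%:E * (w x)%:E)); last first.
  move=> x _; rewrite /f /= -EFinM integral_cst// [X in _ * X = _]nu1_kappa -!EFinM.
  by congr (_%:E); ring.
rewrite ge0_integralZl//.
- by rewrite integral_section_prob -EFinM lee_fin; lra.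
- exact/measurable_EFinP.
- by move=> x _; rewrite lee_fin.
- by rewrite lee_fin mulr_ge0.
Qed.

Let a0 : (0 <= a)%R.
Proof.
by rewrite -lee_fin -aE; apply: integral_ge0.
Qed.

Lemma sum_section_prob_pair_le (q : seq int) : uniq q ->
  \sum_(i <- q) \sum_(j <- q | j != i) \int[P]_t (w (X i t) * w (X j t))%:E <=
  ((lambda * a) ^+ 2 + lambda * (a * s * kappa))%:E.
Proof.
move=> uq.
pose f i j (z : S * S) : \bar R := if j != i then
  P (X i @^-1` ysection J z.1 `&` X j @^-1` ysection J z.2) else 0.
have f0 i j z : 0 <= f i j z by rewrite /f; case: ifP.
have mf i j : measurable_fun setT (f i j).
  rewrite /f; case: (j != i); last exact: measurable_cst.
  have -> : (fun z : S * S => P (X i @^-1` ysection J z.1 `&` X j @^-1` ysection J z.2)) =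
      (fun z => P (ysection (prod_pair i j) z)).
    apply/funext => -[m m']; congr (P _).
    by apply/seteqP; split => t; rewrite /ysection/= !inE.
  exact: measurable_fun_ysection.
have -> : \sum_(i <- q) \sum_(j <- q | j != i) \int[P]_t (w (X i t) * w (X j t))%:E =
    \int[mu \x mu]_z \sum_(i <- q) \sum_(j <- q) f i j z.
  rewrite ge0_integral_sum//; last 2 first.
  - by move=> i; exact: emeasurable_sum.
  - by move=> i z _; exact: sume_ge0.
  apply: eq_bigr => i _; rewrite ge0_integral_sum// big_mkcond/=.
  apply: eq_bigr => j _; rewrite /f; case: (j != i); last by rewrite integral0.
  exact: integral_section_prob_pair.
pose g m := lambda%:E * lebesgue_measure (ysection J m).
have g0 m : 0 <= g m by rewrite mule_ge0// lee_fin ltW.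
have mg : measurable_fun setT g.
  apply: emeasurable_funM; first exact: measurable_cst.
  exact: (measurable_fun_ysection L mJ).
have gE : \int[mu]_m g m = (lambda * a)%:E.
  rewrite ge0_integralZl//; first by rewrite aE EFinM.
  - exact: (measurable_fun_ysection L mJ).
  - by rewrite lee_fin ltW.
have mg1 : measurable_fun setT (fun z : S * S => g z.1).
  exact: (measurableT_comp mg measurable_fst).
have mg2 : measurable_fun setT (fun z : S * S => g z.2).
  exact: (measurableT_comp mg measurable_snd).
have mgg : measurable_fun setT (fun z : S * S => g z.1 * g z.2).
  exact: emeasurable_funM.
have mq : measurable_fun setT (fun z => (L \x nu1)%E (xsection quad z)).
  exact: sigma_finite_measurable_xsection.
have mlq : measurable_fun setT (fun z => lambda%:E * (L \x nu1)%E (xsection quad z)).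
  by apply: emeasurable_funM => //; exact: measurable_cst.
apply: (@le_trans _ _ (\int[mu \x mu]_z
    (g z.1 * g z.2 + lambda%:E * (L \x nu1)%E (xsection quad z)))).
  apply: ge0_le_integral => //.
  - by move=> z _; apply: sume_ge0 => i _; exact: sume_ge0.
  - by apply: emeasurable_sum => i; exact: emeasurable_sum.
  - exact: emeasurable_funD.
  move=> -[m m'] _; rewrite quadE /=.
  apply: le_trans (X_second_order uq (bBJ m) (bBJ m')).
  by apply: lee_sum => i _; rewrite [leRHS]big_mkcond.
rewrite ge0_integralD//; last 2 first.
- by move=> z _; rewrite mule_ge0.
- by move=> z _; rewrite mule_ge0// lee_fin ltW.
rewrite EFinD; apply: leeD.
  rewrite fubini_tonelli1//; last by move=> z; rewrite mule_ge0.
  rewrite /fubini_F /=.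
  rewrite (eq_integral (fun m => (lambda * a)%:E * g m)).
    rewrite ge0_integralZl// ?lee_fin ?mulr_ge0 ?(ltW lambda_gt0)//.
    by rewrite [X in _ * X <= _]gE -EFinM expr2.
  by move=> m _; rewrite ge0_integralZl// [X in _ * X = _]gE muleC.
rewrite ge0_integralZl// ?lee_fin ?(ltW lambda_gt0)//.
rewrite EFinM lee_pmul2l ?lte_fin//.
exact: integral_quad.
Qed.

End MarkedSecondMoment.

(** * Poisson approximation of void probabilities *)

Section ProductExpectation.
Context {d : measure_display} {T : measurableType d} {R : realType}.
Variables (P : probability T R) (I : eqType) (W : I -> T -> R).
Hypothesis mW : forall i, measurable_fun setT (W i).
Hypothesis W01 : forall i t, (0 <= W i t <= 1)%R.
Variables (s c D eta : R) (q : seq I).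
Hypothesis Ws : forall i t, (W i t <= s)%R.
Hypothesis c0 : (0 <= c)%R.
Hypothesis eta0 : (0 < eta)%R.
Hypothesis uq : uniq q.
Hypothesis first_moment : \sum_(i <- q) \int[P]_t (W i t)%:E <= c%:E.
Hypothesis pair_moment :
  \sum_(i <- q) \sum_(j <- q | j != i) \int[P]_t (W i t * W j t)%:E <=
  (c ^+ 2 + D)%:E.

Let W0 i t : (0 <= W i t)%R. Proof. by case/andP: (W01 i t). Qed.

Let Sq t : R := (\sum_(i <- q) W i t)%R.
Let SS t : R := (\sum_(i <- q) W i t ^+ 2)%R.

Let mS : measurable_fun setT Sq. Proof. exact: measurable_sum. Qed.
Let mSS : measurable_fun setT SS.
Proof. by apply: measurable_sum => i; exact: measurable_funX. Qed.
Let S0 t : (0 <= Sq t)%R. Proof. exact: sumr_ge0. Qed.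
Let SS0 t : (0 <= SS t)%R. Proof. by apply: sumr_ge0 => i _; exact: sqr_ge0. Qed.

Let integral_S : \int[P]_t (Sq t)%:E = \sum_(i <- q) \int[P]_t (W i t)%:E.
Proof.
under eq_integral do rewrite -sumEFin.
rewrite ge0_integral_sum// => [i|i t _]; first exact/measurable_EFinP.
by rewrite lee_fin.
Qed.

Let sigma : R := fine (\int[P]_t (Sq t)%:E).

Let sigmaE : \int[P]_t (Sq t)%:E = sigma%:E.
Proof.
rewrite fineK// ge0_fin_numE ?integral_ge0//; first by rewrite integral_S (le_lt_trans first_moment)// ltry.
by move=> t _; rewrite lee_fin.
Qed.

Hypothesis s0 : (0 <= s)%R.

Let int_cst (r : R) : \int[P]_t r%:E = r%:E.
Proof. by rewrite integral_cst// [X in _ * X = _]probability_setT mule1. Qed.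

Lemma integral_sum_sqr_le : \int[P]_t (SS t)%:E <= (s * c)%:E.
Proof.
apply: (@le_trans _ _ (\int[P]_t (s%:E * (Sq t)%:E))).
  apply: ge0_le_integral => //.
  - by move=> t _; rewrite lee_fin.
  - exact/measurable_EFinP.
  - by apply: emeasurable_funM; [exact: measurable_cst|exact/measurable_EFinP].
  move=> t _; rewrite -EFinM lee_fin /SS /Sq mulr_sumr; apply: ler_sum => i _.
  by rewrite expr2 ler_wpM2r.
rewrite ge0_integralZl//; last 2 first.
- exact/measurable_EFinP.
- by move=> t _; rewrite lee_fin.
by rewrite EFinM integral_S lee_wpmul2l ?lee_fin.
Qed.

Lemma integral_sqr_sum_le : \int[P]_t (Sq t ^+ 2)%:E <= (s * c + (c ^+ 2 + D))%:E.
Proof.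
have mWW i j : measurable_fun setT (fun t => W i t * W j t)%R.
  exact: measurable_funM.
pose f i j t : \bar R := if j != i then (W i t * W j t)%:E else 0.
have f0 i j t : 0 <= f i j t.
  by rewrite /f; case: ifP => // _; rewrite lee_fin mulr_ge0.
have mf i j : measurable_fun setT (f i j).
  rewrite /f; case: (j != i); last exact: measurable_cst.
  exact/measurable_EFinP.
have SqE t : (Sq t ^+ 2)%:E = (SS t)%:E + \sum_(i <- q) \sum_(j <- q) f i j t.
  have -> : \sum_(i <- q) \sum_(j <- q) f i j t =
      (\sum_(i <- q) \sum_(j <- q | j != i) W i t * W j t)%R%:E.
    rewrite -sumEFin; apply: eq_bigr => i _.
    by rewrite -sumEFin [RHS]big_mkcond.
  rewrite -EFinD -big_split/= expr2 {1}/Sq mulr_suml; congr (_%:E).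
  apply: eq_big_seq => i iq; rewrite /Sq (bigD1_seq i)//= mulrDr expr2.
  by rewrite mulr_sumr.
under eq_integral do rewrite SqE.
rewrite ge0_integralD//; last 4 first.
- by move=> t _; rewrite lee_fin.
- exact/measurable_EFinP.
- by move=> t _; apply: sume_ge0 => i _; exact: sume_ge0.
- by apply: emeasurable_sum => i; exact: emeasurable_sum.
rewrite EFinD; apply: leeD; first exact: integral_sum_sqr_le.
apply: le_trans pair_moment.
rewrite ge0_integral_sum//; last 2 first.
- by move=> i; exact: emeasurable_sum.
- by move=> i z _; exact: sume_ge0.
apply: lee_sum => i _; rewrite ge0_integral_sum// [leRHS]big_mkcond/=.
apply: lee_sum => j _; rewrite /f; case: (j != i) => //.
by rewrite integral0.
Qed.

(** Bound on the mean square deviation of the sum from [c], where [c] need not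
    be its mean. *)
Lemma integral_sqr_dev_le :
  \int[P]_t ((Sq t - c) ^+ 2)%:E <= (s * c + D + 2 * c * (c - sigma))%:E.
Proof.
have msq : measurable_fun setT (fun t => (Sq t - c) ^+ 2)%R.
  by apply: measurable_funX; apply: measurable_funB => //; exact: measurable_cst.
have : \int[P]_t ((Sq t - c) ^+ 2)%:E + (2 * c * sigma)%:E =
    \int[P]_t (Sq t ^+ 2)%:E + (c ^+ 2)%:E.
  have -> : (2 * c * sigma)%:E = \int[P]_t ((2 * c)%:E * (Sq t)%:E).
    rewrite ge0_integralZl ?sigmaE//; first exact/measurable_EFinP.
    - by move=> t _; rewrite lee_fin.
    - by rewrite lee_fin mulr_ge0.
  have -> : (c ^+ 2)%:E = \int[P]_t (c ^+ 2)%:E.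
    by rewrite int_cst.
  rewrite -ge0_integralD//; last 4 first.
  - by move=> t _; rewrite lee_fin sqr_ge0.
  - exact/measurable_EFinP.
  - by move=> t _; rewrite -EFinM lee_fin !mulr_ge0.
  - by apply: emeasurable_funM; [exact: measurable_cst|exact/measurable_EFinP].
  rewrite -ge0_integralD//; last 3 first.
  - by move=> t _; rewrite lee_fin sqr_ge0.
  - by apply/measurable_EFinP; exact: measurable_funX.
  - by move=> t _; rewrite lee_fin sqr_ge0.
  apply: eq_integral => t _; rewrite -!EFinM -!EFinD; congr (_%:E); ring.
move=> E.
have : \int[P]_t ((Sq t - c) ^+ 2)%:E + (2 * c * sigma)%:E <=
    (s * c + (c ^+ 2 + D))%:E + (c ^+ 2)%:E.
  by rewrite E; apply: leeD => //; exact: integral_sqr_sum_le.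
rewrite -leeBrDr// => /le_trans; apply.
by rewrite -EFinD lee_fin; lra.
Qed.

(** The expectation of the product of the [1 - W i] is close to the
    exponential of minus the expected sum of the [W i], with an error
    controlled by the second moment of that sum. *)
Lemma expectation_prod_sub1_expR :
  (`|fine (\int[P]_t (\prod_(i <- q) (1 - W i t))%R%:E)%E - expR (- c)| <=
  s * c + eta + (s * c + D +
    2 * c * (c - fine (\sum_(i <- q) \int[P]_t (W i t)%:E)%E)) / eta)%R.
Proof.
rewrite -integral_S -/sigma.
pose F t : R := (\prod_(i <- q) (1 - W i t))%R.
pose g t : R := (SS t + (eta + (Sq t - c) ^+ 2 / eta))%R.
have mF : measurable_fun setT F.
  by apply: measurable_prod => i _; apply: measurable_funB => //; exact: measurable_cst.
have F01 t : (0 <= F t <= 1)%R.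
  apply/andP; split; first by apply: prodr_ge0 => i _; rewrite subr_ge0; case/andP: (W01 i t).
  by apply: prodr_ile1 => i _; have := W01 i t => /andP[? ?]; apply/andP; split; lra.
have msq : measurable_fun setT (fun t => (Sq t - c) ^+ 2)%R.
  by apply: measurable_funX; apply: measurable_funB => //; exact: measurable_cst.
have msqe : measurable_fun setT (fun t => eta + (Sq t - c) ^+ 2 / eta)%R.
  apply: measurable_funD; first exact: measurable_cst.
  by apply: measurable_funM => //; exact: measurable_cst.
have mg : measurable_fun setT g by exact: measurable_funD.
have q0 t : (0 <= eta + (Sq t - c) ^+ 2 / eta)%R.
  by rewrite addr_ge0 ?divr_ge0 ?sqr_ge0 ?ltW.
have g0 t : (0 <= g t)%R by rewrite addr_ge0.
have close t : (`|F t - expR (- c)| <= g t)%R.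
  have h1 := prod_sub1_expR q (fun i => W01 i t).
  have h2 := expRN_lipschitz (S0 t) c0.
  have h3 := norm_le_young (Sq t - c) eta0.
  have := ler_distD (expR (- Sq t)) (F t) (expR (- c)).
  by rewrite /g /F /SS => h; apply: (le_trans h); apply: lerD => //; exact: le_trans h2 h3.
have gle : \int[P]_t (g t)%:E <= (s * c + eta + (s * c + D + 2 * c * (c - sigma)) / eta)%:E.
  under eq_integral do rewrite EFinD.
  rewrite ge0_integralD//; last 4 first.
  - by move=> t _; rewrite lee_fin.
  - exact/measurable_EFinP.
  - by move=> t _; rewrite lee_fin.
  - exact/measurable_EFinP.
  rewrite -(addrA (s * c)%R) [leRHS]EFinD; apply: leeD; first exact: integral_sum_sqr_le.
  under eq_integral do rewrite EFinD mulrC EFinM.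
  rewrite ge0_integralD//; last 3 first.
  - by move=> t _; rewrite lee_fin ltW.
  - by move=> t _; rewrite -EFinM lee_fin mulr_ge0 ?sqr_ge0 ?invr_ge0 ?ltW.
  - by apply: emeasurable_funM; [exact: measurable_cst|exact/measurable_EFinP].
  rewrite int_cst [leRHS]EFinD; apply: leeD => //.
  rewrite ge0_integralZl//; last 3 first.
  - exact/measurable_EFinP.
  - by move=> t _; rewrite lee_fin sqr_ge0.
  - by rewrite lee_fin invr_ge0 ltW.
  rewrite (mulrC (s * c + D + 2 * c * (c - sigma))%R) [leRHS]EFinM lee_wpmul2l ?lee_fin ?invr_ge0 ?(ltW eta0)//.
  exact: integral_sqr_dev_le.
set b := (s * c + eta + _)%R in gle *.
have Ffin : \int[P]_t (F t)%:E \is a fin_num.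
  rewrite ge0_fin_numE; last by apply: integral_ge0 => t _; rewrite lee_fin; case/andP: (F01 t).
  apply: (@le_lt_trans _ _ (\int[P]_t 1)); last by rewrite int_cst ltry.
  apply: ge0_le_integral => //.
  - by move=> t _; rewrite lee_fin; case/andP: (F01 t).
  - exact/measurable_EFinP.
  - by move=> t _; rewrite lee_fin; case/andP: (F01 t).
have ce : \int[P]_t (expR (- c))%:E = (expR (- c))%:E.
  by rewrite int_cst.
rewrite -/(F _).
have up : \int[P]_t (F t)%:E <= (expR (- c))%:E + b%:E.
  apply: (@le_trans _ _ (\int[P]_t (expR (- c) + g t)%:E)).
    apply: ge0_le_integral => //.
    - by move=> t _; rewrite lee_fin; case/andP: (F01 t).
    - exact/measurable_EFinP.
    - by apply/measurable_EFinP; apply: measurable_funD => //; exact: measurable_cst.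
    - by move=> t _; rewrite lee_fin; have := close t; rewrite ler_norml => /andP[]; lra.
  under eq_integral do rewrite EFinD.
  rewrite ge0_integralD//; last 2 first.
  - by move=> t _; rewrite lee_fin.
  - exact/measurable_EFinP.
  by apply: leeD => //; rewrite int_cst.
have lo : (expR (- c))%:E <= \int[P]_t (F t)%:E + b%:E.
  rewrite -ce; apply: (@le_trans _ _ (\int[P]_t (F t + g t)%:E)).
    apply: ge0_le_integral => //.
    - by apply/measurable_EFinP; exact: measurable_funD.
    - by move=> t _; rewrite lee_fin; have := close t; rewrite ler_norml => /andP[]; lra.
  under eq_integral do rewrite EFinD.
  rewrite ge0_integralD//; last 4 first.
  - by move=> t _; rewrite lee_fin; case/andP: (F01 t).
  - exact/measurable_EFinP.
  - by move=> t _; rewrite lee_fin.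
  - exact/measurable_EFinP.
  exact: leeD.
move: up lo; rewrite -(fineK Ffin) -!EFinD !lee_fin.
by rewrite ler_norml => h1 h2; apply/andP; split; lra.
Qed.

End ProductExpectation.

Section VoidProbability.
Context {d : measure_display} {T : measurableType d} {R : realType}.
Variables (P : probability T R) (X : int -> {RV P >-> R}).
Context {d2 : measure_display} {S : measurableType d2}.
Variables (mu : probability S R) (M : int -> T -> S).
Hypothesis mM : forall i, measurable_fun setT (M i).
Hypothesis M_law : forall i B, measurable B -> P (M i @^-1` B) = mu B.
Hypothesis M_indep : mutually_independent P M.
Hypothesis XM_indep : independent_families P (fun i t => X i t) M.
Variable e : nat -> int.
Hypothesis e_bij : set_bij [set: nat] [set: int] e.
Variable lambda : R.
Hypothesis lambda_gt0 : (0 < lambda)%R.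
Hypothesis X_Campbell : forall f : R -> \bar R, measurable_fun setT f ->
  (forall x, 0 <= f x) ->
  \sum_(n <oo) \int[P]_w f (X (e n) w) = lambda%:E * \int[lebesgue_measure]_x f x.
Variable nu1 : {sigma_finite_measure set R -> \bar R}.
Variable kappa : R.
Hypothesis nu1_kappa : nu1 setT = kappa%:E.
Hypothesis X_second_order : forall (s : seq int) B0 B1, uniq s ->
  bounded_Borel B0 -> bounded_Borel B1 ->
  \sum_(i <- s) \sum_(j <- s | j != i) P (X i @^-1` B0 `&` X j @^-1` B1) <=
  (lambda%:E * lebesgue_measure B0) * (lambda%:E * lebesgue_measure B1) +
  lambda%:E * \int[lebesgue_measure]_(p in B0) shift_kernel nu1 B1 p.

Variable J : set (R * S).
Hypothesis mJ : measurable J.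
Hypothesis bJ : forall m, bounded_set (ysection J m).
Variable a : R.
Hypothesis aE : \int[mu]_m lebesgue_measure (ysection J m) = a%:E.
Variable s : R.
Hypothesis sE : forall p, (section_prob mu J p <= s)%R.

Let w := section_prob mu J.
(* the first [n] indices of the enumeration [e] *)
Let q n := [seq e k | k <- iota 0 n].
Let A i := [set t | (~` J) (X i t, M i t)].

Let mA i : measurable (A i).
Proof.
have mXM : measurable_fun setT (fun t => (X i t, M i t)).
  exact: measurable_fun_pair.
rewrite /A -[X in measurable X]setTI.
exact: (mXM measurableT _ (measurableC mJ)).
Qed.

Let uniq_q n : uniq (q n).
Proof.
rewrite map_inj_uniq ?iota_uniq// => x y exy.
by have [_ inj _] := e_bij; apply: inj; rewrite ?inE.
Qed.

Lemma section_prob_setC p : section_prob mu (~` J) p = (1 - w p)%R.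
Proof.
apply: EFin_inj; rewrite section_probE; last exact: measurableC.
rewrite EFinB section_probE// -probability_setC; last exact: measurable_xsection.
by congr (mu _); apply/seteqP; split => m /=; rewrite /xsection/= !inE.
Qed.

Lemma void_probability_seq n :
  P (\bigcap_(i in [set` q n]) A i) =
  \int[P]_t (\prod_(i <- q n) (1 - w (X i t)))%R%:E.
Proof.
rewrite (thinning_formula (X := fun i t => X i t) (mu := mu))//.
- by apply: eq_integral => t _; under eq_bigr do rewrite section_prob_setC.
- exact: measurableC.
Qed.

Let sigma n := \sum_(i <- q n) \int[P]_t (w (X i t))%:E.

Let cvg_sigma : fine (sigma n) @[n --> \oo] --> (lambda * a)%R.
Proof.
have := sum_section_prob X_Campbell mJ aE.
have i0 i : 0 <= \int[P]_t (w (X i t))%:E.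
  by apply: integral_ge0 => t _; rewrite lee_fin section_prob_ge0.
have cv : cvgn (fun n => \sum_(0 <= k < n) \int[P]_t (w (X (e k) t))%:E).
  by apply: is_cvg_nneseries => n _ _.
have -> : sigma = fun n => \sum_(0 <= k < n) \int[P]_t (w (X (e k) t))%:E.
  by apply/funext => n; rewrite /sigma /q big_map /index_iota subn0.
move=> E; apply: fine_cvg; rewrite -E.
exact: cv.
Qed.

Let cvg_void : fine (P (\bigcap_(i in [set` q n]) A i)) @[n --> \oo] -->
  fine (P (\bigcap_(i in setT) A i)).
Proof.
have mq n : measurable (\bigcap_(i in [set` q n]) A i).
  by rewrite bigcap_seq; elim: (q n) => [|i s' IH];
    rewrite ?big_nil ?big_cons//; exact: measurableI.
have E : \bigcap_n \bigcap_(i in [set` q n]) A i = \bigcap_(i in setT) A i.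
  apply/seteqP; split => t /= h i _; last by move=> j _; exact: h.
  have [_ _ surj] := e_bij; have [n _ ei] := surj i I.
  apply: (h n.+1) => //=; rewrite -ei; apply: map_f.
  by rewrite mem_iota add0n ltnSn.
have mE : measurable (\bigcap_(i in setT) A i).
  by rewrite -E; apply: bigcap_measurable => //; exists 0%N.
apply: fine_cvg; rewrite fineK ?fin_num_measure// -E.
apply: nonincreasing_cvg_mu => //.
- by rewrite -ge0_fin_numE// fin_num_measure.
- by rewrite E.
- move=> m n mn; apply/subsetPset => t /= h i iq; apply: h => /=.
  move: iq; rewrite /q => /mapP[k]; rewrite mem_iota add0n => /andP[_ km] ->.
  by apply: map_f; rewrite mem_iota add0n (leq_trans km).
Qed.

(** Quantitative Poisson approximation of the probability that no marked point
    falls into [J]. *)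
Lemma void_probability (eta : R) : (0 < eta)%R ->
  (`|fine (P (\bigcap_(i in setT) A i)) - expR (- (lambda * a))| <=
   s * (lambda * a) + eta + (s * (lambda * a) + lambda * a * s * kappa) / eta)%R.
Proof.
move=> eta0; set c := (lambda * a)%R.
have w0 p : (0 <= w p)%R by exact: section_prob_ge0.
have w1 p : (w p <= 1)%R by exact: section_prob_le1.
have s0 : (0 <= s)%R by exact: le_trans (w0 0%R) (sE _).
have a0 : (0 <= a)%R by rewrite -lee_fin -aE; exact: integral_ge0.
have c0 : (0 <= c)%R by rewrite mulr_ge0// ltW.
have bound n : (`|fine (P (\bigcap_(i in [set` q n]) A i)) - expR (- c)| <=
    s * c + eta + (s * c + c * s * kappa + 2 * c * (c - fine (sigma n))) / eta)%R.
  rewrite void_probability_seq.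
  apply: (expectation_prod_sub1_expR (W := fun i t => w (X i t))) => //.
  - move=> i; apply: measurableT_comp => //; exact: measurable_section_prob.
  - by move=> i t; rewrite w0 w1.
  - exact: (sum_section_prob_le e_bij X_Campbell mJ aE).
  - have := sum_section_prob_pair_le lambda_gt0 nu1_kappa X_second_order
      mJ bJ aE sE (uniq_q n).
    by rewrite /c (_ : lambda * a * s * kappa = lambda * (a * s * kappa))%R//; ring.
have lhs : (`|fine (P (\bigcap_(i in [set` q n]) A i)) - expR (- c)|)%R @[n --> \oo] -->
    (`|fine (P (\bigcap_(i in setT) A i)) - expR (- c)|)%R.
  by apply: cvg_norm; apply: cvgB; [exact: cvg_void|exact: cvg_cst].
have rhs : (s * c + eta + (s * c + c * s * kappa + 2 * c * (c - fine (sigma n))) / eta)%R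
    @[n --> \oo] --> (s * c + eta + (s * c + c * s * kappa + 2 * c * (c - c)) / eta)%R.
  apply: cvgD; first exact: cvg_cst.
  apply: cvgM; last exact: cvg_cst.
  apply: cvgD; first exact: cvg_cst.
  apply: cvgM; first exact: cvg_cst.
  by apply: cvgB; [exact: cvg_cst|exact: cvg_sigma].
move: rhs; rewrite subrr mulr0 addr0 => rhs.
by apply: (ler_cvg_to lhs rhs); exact: nearW.
Qed.

End VoidProbability.

(** * Limits under a growing scale *)

Section VoidLimit.
Context {R : realType}.
Variables (v a s : nat -> R) (lambda kappa alpha : R).
Hypothesis v_bound : forall n (eta : R), (0 < eta)%R ->
  (`|v n - expR (- (lambda * a n))| <=
   s n * (lambda * a n) + eta + (s n * (lambda * a n) + lambda * a n * s n * kappa) / eta)%R.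
Hypothesis cvg_s : s n @[n --> \oo] --> (0%R : R).
Hypothesis cvg_a : a n @[n --> \oo] --> alpha.

(** As [s n] vanishes the bound tends to [eta], which is arbitrary. *)
Lemma void_limit : v n @[n --> \oo] --> expR (- (lambda * alpha)).
Proof.
have cvg_c : (lambda * a n)%R @[n --> \oo] --> (lambda * alpha)%R.
  by apply: cvgM; [exact: cvg_cst|exact: cvg_a].
have cvg_e : expR (- (lambda * a n)) @[n --> \oo] --> expR (- (lambda * alpha)).
  apply: continuous_cvg; first exact: continuous_expR.
  exact: cvgN.
apply/cvgrPdist_le => eps eps0.
have eta0 : (0 < eps / 4)%R by rewrite divr_gt0.
set eta := (eps / 4)%R in eta0.
have cvg_b : (s n * (lambda * a n) + eta +
      (s n * (lambda * a n) + lambda * a n * s n * kappa) / eta)%R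
    @[n --> \oo] -->
    (0 * (lambda * alpha) + eta +
      (0 * (lambda * alpha) + lambda * alpha * 0 * kappa) / eta)%R.
  apply: cvgD.
    by apply: cvgD; [exact: cvgM|exact: cvg_cst].
  apply: cvgM; last exact: cvg_cst.
  apply: cvgD; first exact: cvgM.
  by apply: cvgM; [exact: cvgM|exact: cvg_cst].
move: cvg_b; rewrite !(mul0r, mulr0, add0r, addr0) => cvg_b.
near=> n.
have h1 : (s n * (lambda * a n) + eta + (s n * (lambda * a n) + lambda * a n * s n * kappa) / eta
    <= eta + eps / 4)%R.
  near: n; move/cvgrPdist_le : cvg_b => /(_ _ eta0); apply: filterS => n.
  by rewrite ler_norml => /andP[+ _]; rewrite -/eta; lra.
have h2 : (`|expR (- (lambda * alpha)) - expR (- (lambda * a n))| <= eps / 4)%R.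
  by near: n; move/cvgrPdist_le : cvg_e => /(_ _ eta0).
have h3 := v_bound n eta0.
rewrite (le_trans (ler_distD (expR (- (lambda * a n))) _ _))//.
rewrite (distrC _ (v n)); move: h1 h2 h3; rewrite /eta; lra.
Unshelve. all: by end_near. Qed.

End VoidLimit.

(** Mass on the event [rho * D <= N] vanishes as [rho] grows if [D] has no mass
    at zero. *)
Lemma cvg_integral_thin d (T : measurableType d) (R : realType)
    (Q : {measure set T -> \bar R}) (h D N : T -> R) (rho : nat -> R) :
  Q.-integrable setT (EFin \o h) -> (forall x, 0 <= h x)%R ->
  measurable_fun setT D -> measurable_fun setT N -> (forall x, 0 <= D x)%R ->
  Q [set x | D x = 0%R] = 0 -> rho n @[n --> \oo] --> +oo%R ->
  \int[Q]_x (h x * \1_[set x | rho n * D x <= N x] x)%R%:E @[n --> \oo] --> (0 : \bar R).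
Proof.
move=> ih h0 mD mN D0 QD0 rhoy.
have mh : measurable_fun setT h by apply/measurable_EFinP; exact: measurable_int ih.
have mE n : measurable [set x | (rho n * D x <= N x)%R].
  rewrite -[X in measurable X]setTI; apply: measurable_fun_ler => //.
  by apply: measurable_funM => //; exact: measurable_cst.
have mZ : measurable [set x | D x = 0%R].
  rewrite -[X in measurable X]setTI; exact: (mD measurableT [set 0%R] (measurable_set1 _)).
have [|||||_ _] := @dominated_convergence _ _ _ Q setT measurableT
  (fun n x => (h x * \1_[set x | rho n * D x <= N x] x)%R%:E) (cst 0) (EFin \o h);
  last by rewrite integral0.
- move=> n; apply/measurable_EFinP/measurable_funM => //.
- exact: measurable_cst.
- exists [set x | D x = 0%R]; split => // x /=.
  apply: contra_notP => /eqP Dx _.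
  apply: cvg_near_cst.
  have {}Dx : (0 < D x)%R by rewrite lt_neqAle eq_sym Dx D0.
  move/cvgryPgt : rhoy => /(_ (N x / D x)%R); apply: filterS => n hn.
  rewrite indicE memNset ?mulr0//; apply/negP.
  by rewrite -ltNge -ltr_pdivrMr.
- exact: ih.
- apply: aeW => x n _ /=; rewrite lee_fin normrM (ger0_norm (h0 x)).
  by rewrite ler_piMr// indicE; case: (_ \in _); rewrite ?normr1 ?normr0.
Qed.

(** * Projections on a random direction *)

Section Projections.
Context {R : realType}.
Implicit Types (u z : R * R) (phi p r : R).
Local Open Scope ring_scope.

(** Inner product of [z] with the unit vector of angle [phi]. *)
Definition proj z phi : R := z.1 * cos phi + z.2 * sin phi.

(** The homothety of ratio [rho]. *)
Definition scale (rho : R) z : R * R := (rho * z.1, rho * z.2).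

Lemma proj_scale rho z phi : proj (scale rho z) phi = rho * proj z phi.
Proof. by rewrite /proj /scale /=; ring. Qed.

(** A point lies in a cylinder if and only if its distance to the axis is at
    most the radius. *)
Lemma mem_cylinder p phi r z : 0 <= r ->
  minkowski_sum (line p phi) (disc r) z <-> `|proj z phi - p| <= r.
Proof.
move=> r0; have cs := cos2Dsin2 phi; split.
  move=> [x xl [b [_ bd] ->]].
  rewrite -ler_sqr ?nnegrE// real_normK ?num_real//.
  rewrite (_ : proj (x + b) phi - p = b.1 * cos phi + b.2 * sin phi); last first.
    by rewrite -xl /proj /=; ring.
  apply: le_trans bd.
  have -> : (b.1 * cos phi + b.2 * sin phi) ^+ 2 =
    (b.1 ^+ 2 + b.2 ^+ 2) * (cos phi ^+ 2 + sin phi ^+ 2) -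
    (b.1 * sin phi - b.2 * cos phi) ^+ 2 by ring.
  by rewrite cs mulr1 lerBlDr lerDl sqr_ge0.
move=> h; set t := proj z phi - p in h.
exists (z.1 - t * cos phi, z.2 - t * sin phi).
  rewrite /line /=.
  have -> : (z.1 - t * cos phi) * cos phi + (z.2 - t * sin phi) * sin phi =
    proj z phi - t * (cos phi ^+ 2 + sin phi ^+ 2) by rewrite /proj; ring.
  by rewrite cs /t; ring.
exists (t * cos phi, t * sin phi).
  split => //=.
  have -> : (t * cos phi) ^+ 2 + (t * sin phi) ^+ 2 =
    t ^+ 2 * (cos phi ^+ 2 + sin phi ^+ 2) by ring.
  by rewrite cs mulr1 -(real_normK (num_real t)) ler_sqr ?nnegrE.
by case: (z) => z1 z2 /=; congr pair; rewrite /= subrK.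
Qed.

(** On a level set of [proj u], the cosine satisfies a nondegenerate quadratic
    equation. *)
Lemma proj_level_cos u y : u != (0, 0) -> exists c0 c1, forall phi,
  proj u phi = y -> cos phi = c0 \/ cos phi = c1.
Proof.
move=> u0; have [[phi0 h0]|no] := pselect (exists phi, proj u phi = y); last first.
  by exists 0, 0 => phi h; exfalso; apply: no; exists phi.
have A0 : u.1 ^+ 2 + u.2 ^+ 2 != 0.
  apply: contra u0; rewrite paddr_eq0 ?sqr_ge0// !sqrf_eq0.
  by case: (u) => u1 u2 /= /andP[/eqP -> /eqP ->].
exists (cos phi0), (2 * y * u.1 / (u.1 ^+ 2 + u.2 ^+ 2) - cos phi0) => phi h.
have quadratic psi : proj u psi = y ->
    (u.1 ^+ 2 + u.2 ^+ 2) * cos psi ^+ 2 - 2 * y * u.1 * cos psi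
      = u.2 ^+ 2 - y ^+ 2.
  move=> hpsi.
  have E : u.2 * sin psi = y - u.1 * cos psi by rewrite -hpsi /proj; ring.
  have E2 : u.2 ^+ 2 * (1 - cos psi ^+ 2) = (y - u.1 * cos psi) ^+ 2.
    by rewrite -E exprMn sin2cos2.
  apply/eqP; rewrite -subr_eq0; apply/eqP.
  transitivity (- (u.2 ^+ 2 * (1 - cos psi ^+ 2) - (y - u.1 * cos psi) ^+ 2)).
    by ring.
  by rewrite E2 subrr oppr0.
have E := etrans (quadratic _ h) (esym (quadratic _ h0)).
have : (cos phi - cos phi0) *
    (cos phi - (2 * y * u.1 / (u.1 ^+ 2 + u.2 ^+ 2) - cos phi0)) = 0.
  apply: (mulfI A0); rewrite mulr0.
  transitivity (((u.1 ^+ 2 + u.2 ^+ 2) * cos phi ^+ 2 - 2 * y * u.1 * cos phi) -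
    ((u.1 ^+ 2 + u.2 ^+ 2) * cos phi0 ^+ 2 - 2 * y * u.1 * cos phi0)).
    by field.
  by rewrite E subrr.
by move/eqP; rewrite mulf_eq0 !subr_eq0 => /orP[/eqP|/eqP]; [left|right].
Qed.

Lemma measurable_proj u : measurable_fun setT (proj u).
Proof.
by apply: measurable_funD; apply: measurable_funM; try exact: measurable_cst;
  apply: continuous_measurable_fun; [exact: continuous_cos|exact: continuous_sin].
Qed.

End Projections.

Section NoAtoms.
Context {d : measure_display} {T : measurableType d} {R : realType}.
Variables (P : probability T R) (Phi : {RV P >-> R}).
Hypothesis Phi_range : forall w, (0 <= Phi w <= pi)%R.
Hypothesis Phi_continuous : continuous (cdf Phi).

Lemma continuous_cdf_no_atom x : P [set w | Phi w = x] = 0.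
Proof.
have mPhi B : measurable B -> measurable (Phi @^-1` B).
  by move=> mB; rewrite -[X in measurable X]setTI; exact: measurable_funP.
have cv : cdf Phi (x - n.+1%:R^-1)%R @[n --> \oo] --> cdf Phi x.
  apply: continuous_cvg; first exact: Phi_continuous.
  rewrite -[X in _ --> X]subr0; apply: cvgB; first exact: cvg_cst.
  exact: cvg_harmonic.
have le n : cdf Phi (x - n.+1%:R^-1)%R <= cdf Phi x - P [set w | Phi w = x].
  rewrite leeBrDr ?fin_num_measure//; last exact: mPhi (measurable_set1 x).
  rewrite /cdf /distribution /pushforward -measureU.
  - apply: le_measure; rewrite ?inE.
    + apply: measurableU; last exact: mPhi (measurable_set1 x).
      by apply: mPhi; exact: measurable_itv.
    + by apply: mPhi; exact: measurable_itv.
    move=> w [|wx]; rewrite /= !in_itv/=; last by rewrite wx.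
    by move=> h; apply: le_trans h _; rewrite gerBl invr_ge0.
  - by apply: mPhi; exact: measurable_itv.
  - exact: mPhi (measurable_set1 x).
  - apply/seteqP; split => w //= [+ wx]; rewrite wx.
    by rewrite in_itv/= leNgt ltrBlDr ltrDl invr_gt0 ltr0Sn.
have cfin : cdf Phi x \is a fin_num by rewrite fin_num_measure.
have : cdf Phi x <= cdf Phi x - P [set w | Phi w = x].
  rewrite -(cvg_lim _ cv)//; apply: lime_le; first by apply/cvg_ex; exists (cdf Phi x).
  by apply: nearW => n; rewrite (cvg_lim _ cv)//; exact: le.
rewrite leeBrDr ?fin_num_measure//; last exact: mPhi (measurable_set1 x).
rewrite -[leRHS]adde0 leeD2lE// => h.
by apply/eqP; rewrite eq_le h measure_ge0.
Qed.

(** On [[0, pi]] the cosine is injective, so that a level set of the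
    projection consists of at most two angles. *)
Lemma proj_no_atom (u : R * R) y : u != (0%R, 0%R) ->
  P [set w | proj u (Phi w) = y] = 0.
Proof.
move=> u0; have [c0 [c1 h]] := proj_level_cos y u0.
have mPhi B : measurable B -> measurable (Phi @^-1` B).
  by move=> mB; rewrite -[X in measurable X]setTI; exact: measurable_funP.
have mcos c : measurable [set w | cos (Phi w) = c].
  apply: (mPhi (cos @^-1` [set c])).
  rewrite -[X in measurable X]setTI.
  by apply: (continuous_measurable_fun (@continuous_cos R)) => //; exact: measurable_set1.
have null c : P [set w | cos (Phi w) = c] = 0.
  have [[w0 w0c]|no] := pselect (exists w, cos (Phi w) = c); last first.
    rewrite (_ : [set w | _] = set0) ?measure0//.
    by apply/seteqP; split => w //= wc; apply: no; exists w.
  apply/eqP; rewrite eq_le measure_ge0 andbT -(continuous_cdf_no_atom (Phi w0)).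
  apply: le_measure; rewrite ?inE//; first exact: mPhi (measurable_set1 _).
  by move=> w /= wc; apply: cos_inj; rewrite ?in_itv/= ?Phi_range// wc w0c.
apply/eqP; rewrite eq_le measure_ge0 andbT.
apply: (@le_trans _ _ (P ([set w | cos (Phi w) = c0] `|` [set w | cos (Phi w) = c1]))).
  apply: le_measure; rewrite ?inE.
  - apply: (mPhi (proj u @^-1` [set y])).
    rewrite -[X in measurable X]setTI.
    by apply: measurable_proj => //; exact: measurable_set1.
  - exact: measurableU.
  - by move=> w /= /h.
by apply: le_trans (measureU2 _ (mcos c0) (mcos c1)) _;
  rewrite [leLHS](_ : _ = 0)// -[RHS]adde0; congr (_ + _); exact: null.
Qed.

End NoAtoms.

(** * Strips of positions of the cylinders hitting a point *)

Section Strips.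
Context {R : realType}.
Variable mu : probability (R * R)%type R.
Hypothesis mu_no_atom : forall (u : R * R) y, u != (0%R, 0%R) ->
  mu [set m | proj u m.1 = y] = 0.
Variable ell : R.

(** Positive part of the radius of a mark: the radii are nonnegative, but the
    mark space contains pairs with a negative second component. *)
Definition half_width (m : R * R) : R := Num.max m.2 0%R.

Hypothesis ellE : \int[mu]_m (2 * half_width m)%R%:E = ell%:E.

(** The pairs of a position [p] and a mark [m] such that the cylinder with
    position [p] and mark [m] hits the point [z]. *)
Definition strip (z : R * R) : set (R * (R * R)) :=
  [set x | (`|proj z x.2.1 - x.1| <= x.2.2)%R].

Lemma half_width_ge0 m : (0 <= half_width m)%R.
Proof. by rewrite le_max lexx orbT. Qed.

Lemma measurable_half_width : measurable_fun setT half_width.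
Proof.
by apply: measurable_maxr; [exact: measurable_snd|exact: measurable_cst].
Qed.

Lemma measurable_strip z : measurable (strip z).
Proof.
rewrite -[X in measurable X]setTI; apply: measurable_fun_ler => //.
  apply: measurableT_comp => //; apply: measurable_funB.
    apply: (measurableT_comp (@measurable_proj R z)).
    exact: (measurableT_comp measurable_fst measurable_snd).
  exact: measurable_fst.
exact: (measurableT_comp measurable_snd measurable_snd).
Qed.

Lemma ysection_strip z m : ysection (strip z) m =
  `[(proj z m.1 - m.2)%R, (proj z m.1 + m.2)%R]%classic.
Proof.
apply/seteqP; split => p; rewrite /ysection /strip /= inE /= in_itv/= ler_norml.
  by move=> /andP[? ?]; apply/andP; split; lra.
by move=> /andP[? ?]; apply/andP; split; lra.
Qed.

Lemma bounded_ysection_strip z m : bounded_set (ysection (strip z) m).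
Proof. by rewrite ysection_strip; exact: (bounded_Borel_itv _ _ _ _).2. Qed.

Lemma lebesgue_ysection_strip z m :
  lebesgue_measure (ysection (strip z) m) = (2 * half_width m)%R%:E.
Proof.
rewrite ysection_strip lebesgue_measure_itv/= lte_fin /half_width.
case: ifPn => h; first by rewrite -EFinD max_l; [congr (_%:E); ring|lra].
by rewrite max_r ?mulr0//; move: h; rewrite -leNgt; lra.
Qed.

Lemma integrable_half_width : mu.-integrable setT (EFin \o (fun m => 2 * half_width m)%R).
Proof.
apply/integrableP; split.
  apply/measurable_EFinP/measurable_funM; first exact: measurable_cst.
  exact: measurable_half_width.
under eq_integral do rewrite /= ger0_norm ?mulr_ge0 ?half_width_ge0//.
by rewrite ellE ltry.
Qed.

(** Cylinders hitting [z] or [z']. *)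
Definition strip2 z z' := strip z `|` strip z'.

Lemma measurable_strip2 z z' : measurable (strip2 z z').
Proof. by apply: measurableU; exact: measurable_strip. Qed.

Lemma ysection_strip2 z z' m :
  ysection (strip2 z z') m = ysection (strip z) m `|` ysection (strip z') m.
Proof. by apply/seteqP; split => p; rewrite /ysection/= !inE. Qed.

Lemma bounded_ysection_strip2 z z' m : bounded_set (ysection (strip2 z z') m).
Proof.
rewrite ysection_strip2.
have [A [Ar hA]] := bounded_ysection_strip z m.
have [B [Br hB]] := bounded_ysection_strip z' m.
exists (Num.max A B); split; first by rewrite num_real.
move=> x; rewrite gt_max => /andP[Ax Bx] p [hp|hp]; first exact: (hA _ Ax).
exact: (hB _ Bx).
Qed.

Let mlen2 z z' : measurable_fun setT
  (fun m => lebesgue_measure (ysection (strip2 z z') m)).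
Proof.
exact: (measurable_fun_ysection (@lebesgue_measure R) (measurable_strip2 z z')).
Qed.

Let mJ z m : measurable (ysection (strip z) m).
Proof. exact: measurable_ysection (measurable_strip z). Qed.

Lemma lebesgue_ysection_strip2_le z z' m :
  lebesgue_measure (ysection (strip2 z z') m) <= (2 * half_width m + 2 * half_width m)%R%:E.
Proof.
rewrite ysection_strip2 EFinD -{1}(lebesgue_ysection_strip z) -(lebesgue_ysection_strip z').
by apply: measureU2; exact: mJ.
Qed.

Lemma lebesgue_ysection_strip2_ge z z' m :
  (2 * half_width m + 2 * half_width m)%R%:E <=
  lebesgue_measure (ysection (strip2 z z') m) +
  (2 * half_width m * \1_[set m | `|proj z m.1 - proj z' m.1| <= 2 * half_width m] m)%R%:E.
Proof.
rewrite indicE; case: (boolP (m \in _)) => hm; rewrite ?mulr1 ?mulr0 ?adde0.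
  rewrite EFinD leeD2r// -(lebesgue_ysection_strip z).
  rewrite ysection_strip2; apply: le_measure; rewrite ?inE; [exact: mJ| |exact: subsetUl].
  by apply: measurableU; exact: mJ.
rewrite EFinD -{1}(lebesgue_ysection_strip z) -(lebesgue_ysection_strip z').
rewrite ysection_strip2 measureU//; [exact: mJ|exact: mJ|].
apply/seteqP; split => p //= [].
rewrite /ysection /strip /= !inE /= => h1 h2.
move: hm; rewrite notin_setE; apply => /=.
have hw : (m.2 <= half_width m)%R by rewrite le_max lexx.
rewrite (_ : proj z m.1 - proj z' m.1 = (proj z m.1 - p) - (proj z' m.1 - p))%R; last by ring.
by rewrite (le_trans (ler_normB _ _))// mulr_natl mulr2n; apply: lerD; apply: le_trans hw.
Qed.

(** Mean length of the set of positions hitting [z] or [z']. *)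
Definition strip2_mean z z' : R :=
  fine (\int[mu]_m lebesgue_measure (ysection (strip2 z z') m)).

Let int22 : \int[mu]_m (2 * half_width m + 2 * half_width m)%R%:E = (ell + ell)%:E.
Proof.
under eq_integral do rewrite EFinD.
have mh : measurable_fun setT (fun m => (2 * half_width m)%R%:E).
  by have /integrableP[] := integrable_half_width.
have h0 m : 0 <= (2 * half_width m)%R%:E by rewrite lee_fin mulr_ge0 ?half_width_ge0.
by rewrite ge0_integralD// !ellE.
Qed.

Let m22 : measurable_fun setT (fun m => (2 * half_width m + 2 * half_width m)%R%:E).
Proof.
by apply/measurable_EFinP; apply: measurable_funD; apply: measurable_funM;
  try exact: measurable_cst; exact: measurable_half_width.
Qed.

Lemma strip2_mean_le z z' :
  \int[mu]_m lebesgue_measure (ysection (strip2 z z') m) <= (ell + ell)%:E.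
Proof.
rewrite -int22; apply: ge0_le_integral => //.
by move=> m _; exact: lebesgue_ysection_strip2_le.
Qed.

Lemma strip2_meanE z z' :
  \int[mu]_m lebesgue_measure (ysection (strip2 z z') m) = (strip2_mean z z')%:E.
Proof.
rewrite fineK// ge0_fin_numE ?integral_ge0//.
exact: le_lt_trans (strip2_mean_le z z') (ltry _).
Qed.

(** Upper bound for the mean length of the set of positions hitting both [z]
    and [z']. *)
Definition overlap z z' : \bar R :=
  \int[mu]_m (2 * half_width m *
    \1_[set m | `|proj z m.1 - proj z' m.1| <= 2 * half_width m] m)%R%:E.

Let mproj z : measurable_fun setT (fun m : R * R => proj z m.1).
Proof. exact: (measurableT_comp (@measurable_proj R z) measurable_fst). Qed.

Let moverlap z z' :
  measurable [set m : R * R | (`|proj z m.1 - proj z' m.1| <= 2 * half_width m)%R].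
Proof.
rewrite -[X in measurable X]setTI; apply: measurable_fun_ler => //.
  by apply: measurableT_comp => //; exact: measurable_funB.
apply: measurable_funM; first exact: measurable_cst.
exact: measurable_half_width.
Qed.

Lemma strip2_mean_overlap z z' : (ell + ell)%:E <= (strip2_mean z z')%:E + overlap z z'.
Proof.
have h0 m : (0 <= 2 * half_width m * \1_[set m | `|proj z m.1 - proj z' m.1| <= 2 * half_width m] m)%R.
  by rewrite mulr_ge0 ?mulr_ge0 ?half_width_ge0.
have mo : measurable_fun setT (fun m => (2 * half_width m *
    \1_[set m | `|proj z m.1 - proj z' m.1| <= 2 * half_width m] m)%R%:E).
  apply/measurable_EFinP; apply: measurable_funM.
    by apply: measurable_funM; [exact: measurable_cst|exact: measurable_half_width].
  by apply: measurable_indic; exact: moverlap.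
rewrite -int22 -strip2_meanE /overlap -ge0_integralD//; last first.
  by move=> m _; rewrite lee_fin.
apply: ge0_le_integral => //.
- by move=> m _; rewrite lee_fin addr_ge0// mulr_ge0 ?half_width_ge0.
- exact: emeasurable_funD.
- by move=> m _; exact: lebesgue_ysection_strip2_ge.
Qed.

(** Pairs of marks for which some position hits [z] with both marks. *)
Definition near_pairs z : set ((R * R) * (R * R)) :=
  [set x | (`|proj z x.1.1 - proj z x.2.1| <= half_width x.1 + half_width x.2)%R].

Lemma measurable_near_pairs z : measurable (near_pairs z).
Proof.
rewrite -[X in measurable X]setTI; apply: measurable_fun_ler => //.
  apply: measurableT_comp => //; apply: measurable_funB.
    exact: (measurableT_comp (mproj z) measurable_fst).
  exact: (measurableT_comp (mproj z) measurable_snd).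
apply: measurable_funD.
  exact: (measurableT_comp measurable_half_width measurable_fst).
exact: (measurableT_comp measurable_half_width measurable_snd).
Qed.

(** Bound, uniform in the position, for the probability of hitting [z]. *)
Definition concentration z : R := Num.sqrt (fine ((mu \x mu)%E (near_pairs z))).

Let mumu_le1 A : measurable A -> (mu \x mu)%E A <= 1.
Proof.
move=> mA; rewrite /product_measure1; apply: (@le_trans _ _ (\int[mu]_x 1)).
  apply: ge0_le_integral => //; first exact: measurable_fun_xsection.
  by move=> x _; apply: probability_le1; exact: measurable_xsection.
by rewrite integral_cst// mul1e probability_le1.
Qed.

(** Two independent marks: the square of the probability of hitting [p] is
    bounded by the probability that both strips share a point. *)
Lemma section_prob_strip_le z p : (section_prob mu (strip z) p <= concentration z)%R.
Proof.
have w0 := section_prob_ge0 mu (strip z) p.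
rewrite -(ger0_norm w0) -sqrtr_sqr.
apply: ler_wsqrtr; rewrite -lee_fin fineK; last first.
  rewrite ge0_fin_numE//; apply: le_lt_trans (ltry 1).
  exact: mumu_le1 (measurable_near_pairs z).
rewrite expr2 EFinM !section_probE; [|exact: measurable_strip..].
have mx : measurable (xsection (strip z) p) by exact: measurable_xsection (measurable_strip z).
rewrite -product_measure1E//; apply: le_measure; rewrite ?inE.
- exact: measurableX.
- exact: measurable_near_pairs.
move=> [m m'] /=; rewrite /xsection /= !inE /strip /near_pairs /= => -[h1 h2].
have hw : (m.2 <= half_width m)%R by rewrite le_max lexx.
have hw' : (m'.2 <= half_width m')%R by rewrite le_max lexx.
rewrite (_ : proj z m.1 - proj z m'.1 = (proj z m.1 - p) - (proj z m'.1 - p))%R; last by ring.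
by rewrite (le_trans (ler_normB _ _))//; apply: lerD; [apply: le_trans hw|apply: le_trans hw'].
Qed.

Lemma section_prob_strip2_le z z' p :
  (section_prob mu (strip2 z z') p <= concentration z + concentration z')%R.
Proof.
apply: le_trans (lerD (section_prob_strip_le z p) (section_prob_strip_le z' p)).
rewrite -lee_fin EFinD !section_probE;
  [|exact: measurable_strip|exact: measurable_strip|exact: measurable_strip2].
have mx y : measurable (xsection (strip y) p) by exact: measurable_xsection (measurable_strip y).
apply: le_trans (measureU2 _ (mx z) (mx z')).
rewrite (_ : xsection (strip2 z z') p = xsection (strip z) p `|` xsection (strip z') p)//.
by apply/seteqP; split => m; rewrite /xsection/= !inE.
Qed.

End Strips.

Section StripLimits.
Context {R : realType}.
Variable mu : probability (R * R)%type R.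
Hypothesis mu_no_atom : forall (u : R * R) y, u != (0%R, 0%R) ->
  mu [set m | proj u m.1 = y] = 0.
Variable ell : R.
Hypothesis ellE : \int[mu]_m (2 * half_width m)%R%:E = ell%:E.
Variable rho : nat -> R.
Hypothesis rho_gt0 : forall n, (0 < rho n)%R.
Hypothesis rho_y : rho n @[n --> \oo] --> +oo%R.

Let mproj (z : R * R) : measurable_fun setT (fun m : R * R => proj z m.1).
Proof. exact: (measurableT_comp (@measurable_proj R z) measurable_fst). Qed.

Let mproj1 (z : R * R) :
  measurable_fun setT (fun x : (R * R) * (R * R) => proj z x.1.1).
Proof. exact: (measurableT_comp (mproj z) measurable_fst). Qed.

Let mproj2 (z : R * R) :
  measurable_fun setT (fun x : (R * R) * (R * R) => proj z x.2.1).
Proof. exact: (measurableT_comp (mproj z) measurable_snd). Qed.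

(** The event that two independent marks give projections at distance of order
    [1 / rho] shrinks to the null event that the projections coincide. *)
Lemma cvg_concentration (u : R * R) : u != (0%R, 0%R) ->
  concentration mu (scale (rho n) u) @[n --> \oo] --> 0%R.
Proof.
move=> u0.
pose D (x : (R * R) * (R * R)) : R := (`|proj u x.1.1 - proj u x.2.1|)%R.
pose N (x : (R * R) * (R * R)) : R := (half_width x.1 + half_width x.2)%R.
have mD : measurable_fun setT D.
  by apply: measurableT_comp => //; exact: measurable_funB.
have mN : measurable_fun setT N.
  apply: measurable_funD.
    exact: (measurableT_comp (@measurable_half_width R) measurable_fst).
  exact: (measurableT_comp (@measurable_half_width R) measurable_snd).
have mZ : measurable [set x | D x = 0%R].
  rewrite -[X in measurable X]setTI; exact: (mD measurableT [set 0%R] (measurable_set1 _)).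
have QD0 : (mu \x mu)%E [set x | D x = 0%R] = 0.
  rewrite /product_measure1 integral0_eq// => m _ /=.
  rewrite -[RHS](mu_no_atom (proj u m.1) u0); congr (mu _).
  apply/seteqP; split => m'; rewrite /xsection /= inE /D /=.
    by move/eqP; rewrite normr_eq0 subr_eq0 => /eqP.
  by move=> ->; rewrite subrr normr0.
have i1 : (mu \x mu).-integrable setT (EFin \o (fun _ : (R * R) * (R * R) => 1%R)).
  apply/integrableP; split; first exact/measurable_EFinP/measurable_cst.
  under eq_integral do rewrite /= normr1.
  rewrite integral_cst// mul1e -setXTT.
  rewrite [X in X < _]product_measure1E//.
  by rewrite lte_mul_pinfty//; [rewrite fin_num_measure|
    exact: le_lt_trans (probability_le1 mu measurableT) (ltry _)].
have := cvg_integral_thin i1 (fun=> ler01) mD mN (fun=> normr_ge0 _) QD0 rho_y.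
have E n : \int[mu \x mu]_x (1 * \1_[set x | rho n * D x <= N x] x)%R%:E =
    (mu \x mu)%E (near_pairs (scale (rho n) u)).
  have -> : [set x | (rho n * D x <= N x)%R] = near_pairs (scale (rho n) u).
    apply/seteqP; split => x; rewrite /near_pairs /D /N /= !proj_scale;
    by rewrite -mulrBr normrM (ger0_norm (ltW (rho_gt0 n))).
  under eq_integral do rewrite mul1r.
  by rewrite integral_indic ?setIT//; exact: measurable_near_pairs.
under eq_cvg do rewrite E.
move=> /fine_cvg cv.
have : concentration mu (scale (rho n) u) @[n --> \oo] --> Num.sqrt (0%R : R).
  by apply: continuous_cvg; [exact: sqrt_continuous|exact: cv].
by rewrite sqrtr0.
Qed.

(** For distinct points the two strips of positions become disjoint. *)
Lemma cvg_strip2_mean (u u' : R * R) : u != u' ->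
  strip2_mean mu (scale (rho n) u) (scale (rho n) u') @[n --> \oo] --> (ell + ell)%R.
Proof.
move=> uu'.
pose u2 : R * R := ((u.1 - u'.1)%R, (u.2 - u'.2)%R).
have u20 : u2 != (0%R, 0%R).
  apply: contra uu' => /eqP[/eqP + /eqP]; rewrite !subr_eq0.
  by case: (u) (u') => [a b] [c e] /= /eqP -> /eqP ->.
pose D (m : R * R) : R := `|proj u2 m.1|%R.
pose N (m : R * R) : R := (2 * half_width m)%R.
have mN : measurable_fun setT N.
  by apply: measurable_funM; [exact: measurable_cst|exact: measurable_half_width].
have mD : measurable_fun setT D by apply: measurableT_comp.
have QD0 : mu [set x | D x = 0%R] = 0.
  rewrite -[RHS](mu_no_atom 0%R u20); congr (mu _).
  apply/seteqP; split => m'; rewrite /D /=.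
    by move/eqP; rewrite normr_eq0 => /eqP.
  by move=> ->; rewrite normr0.
have N0 m : (0 <= N m)%R by rewrite mulr_ge0 ?half_width_ge0.
have cv := cvg_integral_thin (integrable_half_width ellE) N0 mD mN (fun=> normr_ge0 _) QD0 rho_y.
have E n : \int[mu]_x (N x * \1_[set x | rho n * D x <= N x] x)%R%:E =
    overlap mu (scale (rho n) u) (scale (rho n) u').
  apply: eq_integral => m _; congr (_ * \1_ _ _)%R%:E.
  apply/seteqP; split => x /=; rewrite /D /N /u2 !proj_scale -mulrBr normrM (ger0_norm (ltW (rho_gt0 n)));
  by rewrite (_ : proj u x.1 - proj u' x.1 = proj u2 x.1)%R// /proj /u2 /=; ring.
have {cv}cv : overlap mu (scale (rho n) u) (scale (rho n) u') @[n --> \oo] --> 0.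
  by move: cv; under eq_cvg do rewrite E.
have /fine_cvg cvf := cv.
have ofin : \forall n \near \oo, overlap mu (scale (rho n) u) (scale (rho n) u') \is a fin_num.
  by have /fine_cvgP[] := cv.
have lo : (ell + ell - fine (overlap mu (scale (rho n) u) (scale (rho n) u')))%R @[n --> \oo] --> (ell + ell)%R.
  rewrite -[X in _ --> X]subr0; apply: cvgB; [exact: cvg_cst|exact: cvf].
apply: (squeeze_cvgr _ lo (cvg_cst (ell + ell)%R)).
near=> n.
have fn : overlap mu (scale (rho n) u) (scale (rho n) u') \is a fin_num by near: n.
apply/andP; split; last by rewrite -lee_fin -(strip2_meanE ellE)//; exact: strip2_mean_le.
have := strip2_mean_overlap ellE (scale (rho n) u) (scale (rho n) u').
by rewrite -(fineK fn) -EFinD lee_fin lerBlDr.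
Unshelve. all: by end_near. Qed.

Variables (lambda kappa : R) (V : set (R * (R * R)) -> \bar R).
Hypothesis V_bound : forall (J : set (R * (R * R))) (a s eta : R), measurable J ->
  (forall m, bounded_set (ysection J m)) ->
  \int[mu]_m lebesgue_measure (ysection J m) = a%:E ->
  (forall p, (section_prob mu J p <= s)%R) -> (0 < eta)%R ->
  (`|fine (V J) - expR (- (lambda * a))| <=
   s * (lambda * a) + eta + (s * (lambda * a) + lambda * a * s * kappa) / eta)%R.

Lemma cvg_void_strip (u : R * R) : u != (0%R, 0%R) ->
  fine (V (strip (scale (rho n) u))) @[n --> \oo] --> expR (- (lambda * ell)).
Proof.
move=> u0; apply: (void_limit (a := fun=> ell) (kappa := kappa)
  (s := fun n => concentration mu (scale (rho n) u))) => //.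
- move=> n eta eta0; apply: V_bound => //.
  + exact: measurable_strip.
  + exact: bounded_ysection_strip.
  + by under eq_integral do rewrite lebesgue_ysection_strip.
  + exact: section_prob_strip_le.
- exact: cvg_concentration.
- exact: cvg_cst.
Qed.

Lemma cvg_void_strip2 (u u' : R * R) :
  u != (0%R, 0%R) -> u' != (0%R, 0%R) -> u != u' ->
  fine (V (strip2 (scale (rho n) u) (scale (rho n) u'))) @[n --> \oo] -->
  expR (- (lambda * (ell + ell))).
Proof.
move=> u0 u'0 uu'; apply: (void_limit
  (a := fun n => strip2_mean mu (scale (rho n) u) (scale (rho n) u')) (kappa := kappa)
  (s := fun n => (concentration mu (scale (rho n) u) + concentration mu (scale (rho n) u'))%R)) => //.
- move=> n eta eta0; apply: V_bound => //.
  + exact: measurable_strip2.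
  + exact: bounded_ysection_strip2.
  + exact: (strip2_meanE ellE).
  + exact: section_prob_strip2_le.
- by rewrite -[X in _ --> X]addr0; apply: cvgD; exact: cvg_concentration.
- exact: cvg_strip2_mean.
Qed.

End StripLimits.

(** * Mean square limit of the measure of a random set *)

(** A random subset [xsection (H n) w] of a space of finite mass [k]: its mass
    divided by [k] tends to [q] in mean square as soon as its one-point and
    two-point coverage probabilities tend to [q] and [q ^+ 2]. *)
Section MeanSquareOfSections.
Context {d : measure_display} {T : measurableType d} {R : realType}.
Variable P : probability T R.
Context {d' : measure_display} {Z : measurableType d'}.
Variable kap : {sigma_finite_measure set Z -> \bar R}.
Variables (k q : R) (z0 : Z).
Hypothesis k0 : (0 < k)%R.
Hypothesis kapE : kap setT = k%:E.
Hypothesis q0 : (0 <= q)%R.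
Hypothesis mpoint : forall z : Z, measurable [set z].
Hypothesis kap_point : forall z, kap [set z] = 0.
Hypothesis mdiag : measurable [set x : Z * Z | x.1 = x.2].
Variable H : nat -> set (T * Z).
Hypothesis mH : forall n, measurable (H n).
Hypothesis cvg_first : forall z, z <> z0 ->
  fine (P (ysection (H n) z)) @[n --> \oo] --> q.
Hypothesis cvg_second : forall z z', z <> z0 -> z' <> z0 -> z <> z' ->
  fine (P (ysection (H n) z `&` ysection (H n) z')) @[n --> \oo] --> (q ^+ 2)%R.

Let D n t := kap (xsection (H n) t).

Let mx n t : measurable (xsection (H n) t). Proof. exact: measurable_xsection. Qed.
Let my n z : measurable (ysection (H n) z). Proof. exact: measurable_ysection. Qed.

Let D0 n t : 0 <= D n t. Proof. by []. Qed.

Let Dk n t : D n t <= k%:E.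
Proof. by rewrite -kapE; apply: le_measure; rewrite ?inE. Qed.

Let mD n : measurable_fun setT (D n). Proof. exact: measurable_fun_xsection. Qed.

Let Dfin n t : D n t \is a fin_num.
Proof. by rewrite ge0_fin_numE//; exact: le_lt_trans (Dk n t) (ltry _). Qed.

Let sfkk : sigma_finite setT (kap \x kap).
Proof. by apply: sigma_finite_product; rewrite kapE ltry. Qed.

Let sfP : sigma_finite setT P. Proof. exact: sigma_finiteT. Qed.

Let kkE : (kap \x kap)%E setT = (k * k)%:E.
Proof. by rewrite -setXTT product_measure1E// EFinM; congr (_ * _); exact: kapE. Qed.

(* pairs of points that both belong to the random set *)
Let HH n : set (T * (Z * Z)) := [set x | H n (x.1, x.2.1) /\ H n (x.1, x.2.2)].

Let mHH n : measurable (HH n).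
Proof.
apply: measurableI; rewrite -[X in measurable X]setTI.
  apply: (measurable_fun_pair (f := fst) (g := fun x : T * (Z * Z) => x.2.1)) => //.
  exact: (measurableT_comp measurable_fst measurable_snd).
apply: (measurable_fun_pair (f := fst) (g := fun x : T * (Z * Z) => x.2.2)) => //.
exact: (measurableT_comp measurable_snd measurable_snd).
Qed.

Let ysHH n z z' : ysection (HH n) (z, z') = ysection (H n) z `&` ysection (H n) z'.
Proof. by apply/seteqP; split => t; rewrite /ysection /= !inE. Qed.

Let integral_D n : \int[P]_t D n t = \int[kap]_z P (ysection (H n) z).
Proof. exact: (tonelli_sections P kap (mH n)). Qed.

Let integral_DD n : \int[P]_t (D n t * D n t) =
  \int[kap \x kap]_z P (ysection (HH n) z).
Proof.
rewrite -(sigma_finite_tonelli_sections sfP sfkk (mHH n)).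
apply: eq_integral => t _.
have -> : xsection (HH n) t = xsection (H n) t `*` xsection (H n) t.
  by apply/seteqP; split => -[z z']; rewrite /xsection /= !inE.
by rewrite [RHS]product_measure1E.
Qed.

Let integrable_one d1 (U : measurableType d1) (m : {measure set U -> \bar R}) c :
  m setT = c%:E -> m.-integrable setT (cst 1 : U -> \bar R).
Proof.
move=> mc; apply/integrableP; split; first exact: measurable_cst.
under eq_integral do rewrite /= normr1.
by rewrite integral_cst// mul1e mc ltry.
Qed.

Let cvg_integral_D : \int[P]_t D n t @[n --> \oo] --> (q * k)%:E.
Proof.
under eq_cvg do rewrite integral_D.
have [|||||_ _] := @dominated_convergence _ _ _ kap setT measurableT
  (fun n z => P (ysection (H n) z)) (cst q%:E) (cst 1).
- by move=> n; exact: measurable_fun_ysection.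
- exact: measurable_cst.
- exists [set z0]; split; [exact: mpoint|exact: kap_point|].
  move=> z /=; apply: contra_notP => zz0 _.
  apply/fine_cvgP; split; last exact: cvg_first.
  by apply: nearW => n; rewrite fin_num_measure.
- exact: integrable_one kapE.
- by apply: aeW => z n _; rewrite gee0_abs// probability_le1.
by rewrite integral_cst// [X in _ --> _ * X -> _]kapE -EFinM.
Qed.

Let cvg_integral_DD : \int[P]_t (D n t * D n t) @[n --> \oo] --> (q ^+ 2 * (k * k))%:E.
Proof.
under eq_cvg do rewrite integral_DD.
have mv n : measurable_fun setT (fun z => P (ysection (HH n) z)).
  exact: measurable_fun_ysection.
have [|||||_ _] := @dominated_convergence _ _ _ (kap \x kap)%E setT measurableT
  (fun n z => P (ysection (HH n) z)) (cst (q ^+ 2)%:E) (cst 1).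
- exact: mv.
- exact: measurable_cst.
- pose N : set (Z * Z) := ([set z0] `*` setT `|` setT `*` [set z0]) `|` [set x | x.1 = x.2].
  have mN1 : measurable ([set z0] `*` setT : set (Z * Z)) by exact: measurableX.
  have mN2 : measurable (setT `*` [set z0] : set (Z * Z)) by exact: measurableX.
  have mN12 := measurableU _ _ mN1 mN2.
  exists N; split; first exact: measurableU.
    rewrite [X in X = _]null_set_setU// ?null_set_setU//.
    + by rewrite [LHS]product_measure1E// [X in X * _]kap_point mul0e.
    + by rewrite [LHS]product_measure1E// [X in _ * X]kap_point mule0.
    transitivity (\int[kap]_z kap (xsection [set x : Z * Z | x.1 = x.2] z)) => //.
    rewrite integral0_eq// => z _ /=.
    rewrite -[RHS](kap_point z); congr (kap _).
    by apply/seteqP; split => z'; rewrite /xsection /= inE.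
  move=> [z z'] /= h; apply: contrapT => /not_orP[/not_orP[/= h1 h2] /= h3].
  apply: h => _; apply/fine_cvgP; split.
    by apply: nearW => n; rewrite fin_num_measure//; exact: measurable_ysection.
  rewrite (_ : fine \o _ = fun n => fine (P (ysection (H n) z `&` ysection (H n) z'))).
    apply: cvg_second => //.
      by move=> zz; apply: h1.
    by move=> zz; apply: h2.
  by apply/funext => n /=; rewrite ysHH.
- exact: integrable_one kkE.
- apply: aeW => z n _; rewrite gee0_abs// probability_le1//.
  exact: measurable_ysection.
by rewrite integral_cst// [X in _ --> _ * X -> _]kkE -EFinM.
Qed.

Lemma mean_square_sections :
  \int[P]_t ((fine (kap (xsection (H n) t)) / k - q) ^+ 2)%R%:E @[n --> \oo] --> 0.
Proof.
pose dn n t : R := (fine (D n t) / k)%R.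
have mdn n : measurable_fun setT (dn n).
  apply: measurable_funM; last exact: measurable_cst.
  exact: measurableT_comp.
have ki : (0 <= k^-1)%R by rewrite invr_ge0 ltW.
have dn0 n t : (0 <= dn n t)%R by rewrite mulr_ge0// fine_ge0.
have m1 n : \int[P]_t (dn n t)%:E = (k^-1)%:E * \int[P]_t D n t.
  rewrite -ge0_integralZl//; apply: eq_integral => t _.
  by rewrite /dn mulrC EFinM fineK.
have m2 n : \int[P]_t (dn n t ^+ 2)%:E = (k^-1 ^+ 2)%:E * \int[P]_t (D n t * D n t).
  rewrite -ge0_integralZl//; last 3 first.
  - exact: emeasurable_funM.
  - by move=> t _; rewrite mule_ge0.
  - by rewrite lee_fin sqr_ge0.
  apply: eq_integral => t _.
  by rewrite -[D n t](fineK (Dfin n t)) -!EFinM /dn; congr (_%:E); ring.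
have E n : \int[P]_t ((dn n t - q) ^+ 2)%:E + (2 * q)%:E * \int[P]_t (dn n t)%:E =
    \int[P]_t (dn n t ^+ 2)%:E + (q ^+ 2)%:E.
  have -> : (q ^+ 2)%:E = \int[P]_t (q ^+ 2)%:E.
    by rewrite integral_cst// [X in _ * X]probability_setT mule1.
  rewrite -ge0_integralZl//; last 3 first.
  - exact/measurable_EFinP.
  - by move=> t _; rewrite lee_fin.
  - by rewrite lee_fin mulr_ge0.
  rewrite -ge0_integralD//; last 4 first.
  - by move=> t _; rewrite lee_fin sqr_ge0.
  - apply/measurable_EFinP; apply: measurable_funX.
    by apply: measurable_funB => //; exact: measurable_cst.
  - by move=> t _; rewrite -EFinM lee_fin; apply: mulr_ge0 => //; exact: mulr_ge0.
  - by apply: emeasurable_funM; [exact: measurable_cst|exact/measurable_EFinP].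
  rewrite -ge0_integralD//; last 3 first.
  - by move=> t _; rewrite lee_fin sqr_ge0.
  - by apply/measurable_EFinP; exact: measurable_funX.
  - by move=> t _; rewrite lee_fin sqr_ge0.
  by apply: eq_integral => t _; rewrite -EFinM -!EFinD; congr (_%:E); ring.
have c1 : \int[P]_t (dn n t)%:E @[n --> \oo] --> q%:E.
  under eq_cvg do rewrite m1.
  have : (k^-1)%:E * \int[P]_t D n t @[n --> \oo] --> (k^-1)%:E * (q * k)%:E.
    by apply: cvgeZl => //; exact: cvg_integral_D.
  by rewrite -EFinM (_ : k^-1 * (q * k) = q)%R//; field; rewrite gt_eqF.
have c2 : \int[P]_t (dn n t ^+ 2)%:E @[n --> \oo] --> (q ^+ 2)%:E.
  under eq_cvg do rewrite m2.
  have : (k^-1 ^+ 2)%:E * \int[P]_t (D n t * D n t) @[n --> \oo] -->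
      (k^-1 ^+ 2)%:E * (q ^+ 2 * (k * k))%:E.
    by apply: cvgeZl => //; exact: cvg_integral_DD.
  by rewrite -EFinM (_ : k^-1 ^+ 2 * (q ^+ 2 * (k * k)) = q ^+ 2)%R//; field; rewrite gt_eqF.
have fin1 n : \int[P]_t (dn n t)%:E \is a fin_num.
  rewrite m1 fin_numM// integral_D ge0_fin_numE ?integral_ge0//.
  apply: (@le_lt_trans _ _ (\int[kap]_z 1)).
    apply: ge0_le_integral => //; first exact: measurable_fun_ysection.
    by move=> z _; rewrite probability_le1.
  by rewrite integral_cst// mul1e [X in X < _]kapE ltry.
have E' n : \int[P]_t ((dn n t - q) ^+ 2)%:E =
    \int[P]_t (dn n t ^+ 2)%:E + (q ^+ 2)%:E - (2 * q)%:E * \int[P]_t (dn n t)%:E.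
  by rewrite -E addeK// fin_numM.
under eq_cvg do rewrite E'.
have : \int[P]_t (dn n t ^+ 2)%:E + (q ^+ 2)%:E - (2 * q)%:E * \int[P]_t (dn n t)%:E
    @[n --> \oo] --> (q ^+ 2)%:E + (q ^+ 2)%:E - (2 * q)%:E * q%:E.
  apply: cvgeB => //; last exact: cvgeZl.
  by apply: cvgeD => //; exact: cvg_cst.
by rewrite -EFinM -EFinD (_ : q ^+ 2 + q ^+ 2 - 2 * q * q = 0)%R//; ring.
Qed.

End MeanSquareOfSections.

(** * Area in the plane *)

Section PlaneArea.
Context {R : realType}.
Implicit Types (K : set (R * R)).

Local Notation leb := (@lebesgue_measure R).
Local Notation RR := (measurableTypeR R * measurableTypeR R)%type.

(** A closed set is the intersection over [n] of the unions of the squares of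
    half-side [1 / (n + 1)] with rational centre that meet it. *)
Lemma closed_measurable2 K : closed K -> measurable (K : set RR).
Proof.
move=> cK.
pose sq (n : nat) (c : rat * rat) : set RR :=
  [set z : R * R | (`|z.1 - ratr c.1| < n.+1%:R^-1)%R] `&`
  [set z : R * R | (`|z.2 - ratr c.2| < n.+1%:R^-1)%R].
have msq n c : measurable (sq n c).
  apply: measurableI; rewrite -[X in measurable X]setTI; apply: measurable_fun_ltr => //.
    apply: measurableT_comp => //; apply: measurable_funB; last exact: measurable_cst.
    exact: measurable_fst.
  apply: measurableT_comp => //; apply: measurable_funB; last exact: measurable_cst.
  exact: measurable_snd.
pose U n := \bigcup_c (if pselect (exists2 z, K z & sq n c z) then sq n c else set0).
have mU n : measurable (U n).
  apply: countable_bigcupT_measurable => [|c]; first exact: countableP.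
  by case: pselect => h; [exact: msq|exact: measurable0].
suff -> : K = \bigcap_n U n by exact: bigcap_measurable.
apply/seteqP; split => [z Kz n _|z Uz].
  have e0 : (0 < n.+1%:R^-1 :> R)%R by rewrite invr_gt0 ltr0Sn.
  have rat_near (x : R) : exists r : rat, (`|x - ratr r| < n.+1%:R^-1)%R.
    move: e0; set eps := (n.+1%:R^-1)%R => e0.
    have /rat_in_itvoo[r] : (x - eps < x + eps)%R by lra.
    rewrite in_itv/= => /andP[r1 r2]; exists r.
    by rewrite ltr_norml; apply/andP; split; lra.
  have [r1 h1] := rat_near z.1; have [r2 h2] := rat_near z.2.
  exists (r1, r2) => //; case: pselect => //= no.
  by exfalso; apply: no; exists z.
apply: cK => B /nbhs_ballP[eps /= eps0 hB].
have [n hn] : exists n : nat, (2 * n.+1%:R^-1 < eps)%R.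
  exists (Num.truncn (2 / eps)).
  rewrite ltr_pdivrMr ?ltr0Sn// mulrC -ltr_pdivrMr//.
  exact: truncnS_gt.
have [[r1 r2] _] := Uz n I.
case: pselect => // -[[k1 k2] Kk [/= hk1 hk2]] [/= hz1 hz2].
exists (k1, k2); split => //; apply: hB; split => /=.
  rewrite /ball/= (_ : z.1 - k1 = (z.1 - ratr r1) - (k1 - ratr r1))%R; last by ring.
  apply: (le_lt_trans (ler_normB _ _)); apply: lt_trans hn.
  by rewrite mulr_natl mulr2n ltrD.
rewrite /ball/= (_ : z.2 - k2 = (z.2 - ratr r2) - (k2 - ratr r2))%R; last by ring.
apply: (le_lt_trans (ler_normB _ _)); apply: lt_trans hn.
by rewrite mulr_natl mulr2n ltrD.
Qed.

Lemma area_point (z : R * R) : area [set z] = 0.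
Proof.
case: z => x y; rewrite (_ : [set (x, y)] = [set x] `*` [set y]); last first.
  by apply/seteqP; split => -[a b] /= => [[-> ->]|[-> ->]].
rewrite /area product_measure1E//.
by rewrite [X in X * _]lebesgue_measure_set1 mul0e.
Qed.

Lemma compact_area_lty K : compact K -> area K < +oo.
Proof.
move=> cK; have mK := closed_measurable2 (compact_closed (@norm_hausdorff _ _) cK).
have [M [_ hM]] := compact_bounded cK.
pose N : R := (`|M| + 1)%R.
have MN : (M < N)%R by rewrite /N (le_lt_trans (ler_norm M))// ltrDl.
have N0 : (0 <= N)%R by rewrite /N addr_ge0.
have sub : K `<=` `[(- N)%R, N] `*` `[(- N)%R, N].
  move=> z Kz; have := hM _ MN _ Kz.
  rewrite /= prod_normE /= ge_max => /andP[h1 h2].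
  by split; rewrite /= in_itv/= -ler_norml.
apply: (@le_lt_trans _ _ (area (`[(- N)%R, N] `*` `[(- N)%R, N]))).
  by apply: le_measure; rewrite ?inE//; apply: measurableX; exact: measurable_itv.
rewrite /area product_measure1E//.
rewrite [X in X * _]lebesgue_measure_itv [X in _ * X]lebesgue_measure_itv /=.
case: ifP => _; last by rewrite mule0 ltry.
by rewrite -EFinD -EFinM ltry.
Qed.

Lemma interior_area_gt0 K : measurable (K : set RR) -> interior K (0%R, 0%R) -> 0 < area K.
Proof.
move=> mK /nbhs_ballP[eps /= eps0 hB].
have sub : `](- eps)%R, eps[ `*` `](- eps)%R, eps[ `<=` K.
  move=> [x y] [/=]; rewrite !in_itv/= -!ltr_norml => hx hy.
  by apply: hB; split; rewrite /ball/= sub0r normrN.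
apply: (@lt_le_trans _ _ (area (`](- eps)%R, eps[ `*` `](- eps)%R, eps[))); last first.
  by apply: le_measure; rewrite ?inE//; apply: measurableX; exact: measurable_itv.
rewrite /area product_measure1E//.
rewrite [X in X * _]lebesgue_measure_itv [X in _ * X]lebesgue_measure_itv /=.
rewrite lte_fin ifT; last by rewrite gtrN.
by rewrite -EFinD -EFinM lte_fin mulr_gt0// opprK addr_gt0.
Qed.

Lemma lebesgue_measure_scale (c : R) (B : set R) : (0 < c)%R -> measurable B ->
  leb ((fun x => x / c)%R @^-1` B) = c%:E * leb B.
Proof.
move=> c0 mB.
have mphi : measurable_fun setT (fun x : measurableTypeR R => (x / c)%R : measurableTypeR R).
  by apply: measurable_funM => //; exact: measurable_cst.
have ci : (0 <= c^-1)%R by rewrite invr_ge0 ltW.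
pose m : {measure set (measurableTypeR R) -> \bar R} :=
  mscale (NngNum ci) (pushforward leb (fun x : measurableTypeR R => (x / c)%R : measurableTypeR R)).
have mE A : m mphi A = (c^-1)%:E * leb ((fun x => x / c)%R @^-1` A) by [].
suff -> : leb B = m mphi B.
  by rewrite mE muleA -EFinM divff ?mul1e// gt_eqF.
apply: lebesgue_measure_unique => // _ [[x y] _ <-]; rewrite mE.
rewrite (_ : (fun x => x / c)%R @^-1` _ = `](x * c)%R, (y * c)%R]%classic); last first.
  apply/seteqP; split => z /=; rewrite !in_itv/= ltr_pdivlMr// ler_pdivrMr//.
rewrite !lebesgue_measure_itv/= !lte_fin ltr_pM2r//.
case: ifP => _; last by rewrite mule0.
by rewrite -!EFinD -EFinM -mulrBl mulrCA mulVf ?mulr1// gt_eqF.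
Qed.

Lemma dilateE (c : R) K : (0 < c)%R ->
  dilate c K = [set z | K (z.1 / c, z.2 / c)%R].
Proof.
move=> c0; apply/seteqP; split => [_ [[x y] Kz <-]|[x y] /= Kz] /=.
  by rewrite ![(c * _)%R]mulrC !mulfK ?gt_eqF.
exists (x / c, y / c)%R => //=.
by rewrite ![(c * _)%R]mulrC !divfK ?gt_eqF.
Qed.

Lemma area_dilate (c : R) K : (0 < c)%R -> measurable (K : set RR) ->
  area (dilate c K) = (c ^+ 2)%:E * area K.
Proof.
move=> c0 mK; rewrite /area /product_measure1 dilateE//.
have mphi : measurable_fun setT (fun x : measurableTypeR R => (x / c)%R : measurableTypeR R).
  by apply: measurable_funM => //; exact: measurable_cst.
pose g (x : measurableTypeR R) := leb (xsection K x).
have mg : measurable_fun setT g by exact: measurable_fun_xsection.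
transitivity (\int[leb]_x (c%:E * g (x / c)%R)).
  apply: eq_integral => x _ /=; rewrite /g -lebesgue_measure_scale//; last exact: measurable_xsection.
rewrite ge0_integralZl//; last 2 first.
- exact: measurableT_comp.
- by rewrite lee_fin ltW.
rewrite expr2 EFinM -muleA; congr (_ * _).
pose m : {measure set (measurableTypeR R) -> \bar R} :=
  pushforward leb (fun x : measurableTypeR R => (x / c)%R : measurableTypeR R).
transitivity (\int[m mphi]_x g x).
  by rewrite ge0_integral_pushforward.
pose m2 : {measure set (measurableTypeR R) -> \bar R} := mscale (NngNum (ltW c0)) leb.
rewrite (@eq_measure_integral _ _ _ _ m2).
  by rewrite ge0_integral_mscale.
by move=> A mA _; exact: lebesgue_measure_scale.
Qed.

End PlaneArea.

(** * Covered area of the cylinder process *)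

Section CylinderProcess.
Context {d : measure_display} {T : measurableType d} {R : realType}.
Variables (P : probability T R) (X Phi Rad : int -> {RV P >-> R}).
Hypothesis Rad_range : forall i w, (0 <= Rad i w)%R.

Local Notation RR := (measurableTypeR R * measurableTypeR R)%type.

(** The mark of the point [i]: angle and radius of its cylinder. *)
Definition mark (i : int) (w : T) : R * R := (Phi i w, Rad i w).

Lemma measurable_mark i : measurable_fun setT (mark i).
Proof. exact: measurable_fun_pair. Qed.

(** The event that no marked point falls into [J]. *)
Definition void (J : set (R * (R * R))) : set T :=
  \bigcap_(i in [set: int]) [set w | (~` J) (X i w, mark i w)].

Lemma cylinder_process_strip w z :
  ~ cylinder_process X Phi Rad w z <-> void (strip z) w.
Proof.
split=> [h i _ /= hs|h [i _]].
  by apply: h; exists i => //; apply/mem_cylinder.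
by move=> /mem_cylinder => /(_ (Rad_range i w)); exact: h.
Qed.

Lemma void_strip2 z z' : void (strip2 z z') = void (strip z) `&` void (strip z').
Proof.
apply/seteqP; split => [w h|w [h h'] i _ /= [hs|hs]].
- by split => i _ /= hs; apply: (h i I); [left|right].
- exact: (h i I hs).
- exact: (h' i I hs).
Qed.

Lemma measurable_void_scale (c : R) :
  measurable [set x : T * RR | void (strip (scale c x.2)) x.1].
Proof.
have -> : [set x : T * RR | void (strip (scale c x.2)) x.1] =
    ~` \bigcup_i [set x : T * RR |
      (`|proj (scale c x.2) (Phi i x.1) - X i x.1| <= Rad i x.1)%R].
  apply/seteqP; split => [x h [i _ hi]|x h i _ hi].
    exact: (h i I hi).
  by apply: h; exists i.
apply: measurableC; apply: countable_bigcupT_measurable => [|i]; first exact: countableP.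
have comp1 (f : T -> R) : measurable_fun setT f ->
    measurable_fun setT (fun x : T * RR => f x.1).
  by move=> mf; exact: (measurableT_comp mf measurable_fst).
have m21 : measurable_fun setT (fun x : T * RR => x.2.1 : R).
  exact: (measurableT_comp measurable_fst measurable_snd).
have m22 : measurable_fun setT (fun x : T * RR => x.2.2 : R).
  exact: (measurableT_comp measurable_snd measurable_snd).
have mcos : measurable_fun setT (fun w => cos (Phi i w)).
  apply: (measurableT_comp (f := @cos R)) => //.
  exact: continuous_measurable_fun (@continuous_cos R).
have msin : measurable_fun setT (fun w => sin (Phi i w)).
  apply: (measurableT_comp (f := @sin R)) => //.
  exact: continuous_measurable_fun (@continuous_sin R).
rewrite -[X in measurable X]setTI; apply: measurable_fun_ler => //; last exact: comp1.
apply: measurableT_comp => //; apply: measurable_funB; last exact: comp1.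
rewrite /proj /=; apply: measurable_funD; apply: measurable_funM.
- by apply: measurable_funM => //; exact: measurable_cst.
- exact: (comp1 (fun w => cos (Phi i w))).
- by apply: measurable_funM => //; exact: measurable_cst.
- exact: (comp1 (fun w => sin (Phi i w))).
Qed.

End CylinderProcess.

Lemma lebesgue_measure_centered_itv (R : realType) (r : R) : (0 <= r)%R ->
  lebesgue_measure `[(- r)%R, r] = (2 * r)%R%:E.
Proof.
move=> r0; rewrite lebesgue_measure_itv/= lte_fin; case: ifPn => h.
  by rewrite -EFinD; congr (_%:E); ring.
by have -> : r = 0%R; [lra|rewrite mulr0].
Qed.

Theorem theorem1 (R : realType) (d : measure_display) (Omega : measurableType d)
  (P : probability Omega R) (X Phi Rad : int -> {RV P >-> R}) (lambda : R)
  (K : set (R * R))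
  (X_simple : simple_process X)
  (X_locally_finite : locally_finite_process X)
  (X_stationary : stationary_process X)
  (lambda_gt0 : (0 < lambda)%R)
  (X_intensity : intensity X = lambda%:E)
  (Phi_range : forall i w, (0 <= Phi i w <= pi)%R)
  (Rad_range : forall i w, (0 <= Rad i w)%R)
  (marks_components : independent_variables P (Phi 0%R) (Rad 0%R))
  (marks_independent : mutually_independent P (fun i w => (Phi i w, Rad i w)))
  (marks_identical : identically_distributed P (fun i w => (Phi i w, Rad i w)))
  (X_marks_independent :
    independent_families P (fun i w => X i w) (fun i w => (Phi i w, Rad i w)))
  (K_compact : compact K)
  (K_star_shaped : star_shaped K)
  (K_inner : interior K (0%R, 0%R))
  (X_Brillinger : Brillinger_mixing X)
  (Rad_mean : 'E_P[Rad 0%R] < +oo)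
  (Phi_continuous : continuous (cdf (Phi 0%R))) :
  let mean_length :=
    'E_P[fun w => fine (lebesgue_measure `[(- Rad 0 w)%R, Rad 0%R w])] in
  'E_P[fun w => ((fine (area (cylinder_process X Phi Rad w `&` dilate rho K))
                   / fine (area (dilate rho K))
                 - (1 - expR (- (lambda * fine mean_length)))) ^+ 2)%R]
    @[rho --> +oo%R] --> 0.
Proof.
move=> mean_length.
have [e e_bij] := int_enumeration.
have [Psi2 [nu [nu_red nu_tv]]] := X_Brillinger 1%N isT.
have pos_fin : sm_pos nu setT < +oo.
  by apply: le_lt_trans nu_tv; rewrite /total_variation leeDl.
have [nu1 [nu1E nu1_fin]] := tuple1_marginal pos_fin.
have nu1_kappa : nu1 setT = (fine (nu1 setT))%:E.
  by rewrite fineK// ge0_fin_numE.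
set kappa := fine (nu1 setT) in nu1_kappa.
have mM0 := measurable_mark Phi Rad 0%R.
pose M0 : {RV P >-> (R * R)%type} :=
  HB.pack (mark Phi Rad 0%R) (isMeasurableFun.Build _ _ _ _ _ mM0).
pose mu : probability (R * R)%type R := distribution P M0.
have M_law i B : measurable B -> P (mark Phi Rad i @^-1` B) = mu B.
  by move=> mB; exact: (marks_identical i 0%R B mB).
have X_Campbell := Campbell e_bij X_locally_finite X_stationary X_intensity lambda_gt0.
have X_second_order := second_order_bound e_bij X_locally_finite X_stationary
  X_intensity lambda_gt0 Psi2 nu_red nu_tv nu1E.
pose V (J : set (R * (R * R))) := P (void X Phi Rad J).
have V_bound (J : set (R * (R * R))) (a s eta : R) : measurable J ->
    (forall m, bounded_set (ysection J m)) ->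
    \int[mu]_m lebesgue_measure (ysection J m) = a%:E ->
    (forall p, (section_prob mu J p <= s)%R) -> (0 < eta)%R ->
    (`|fine (V J) - expR (- (lambda * a))| <=
     s * (lambda * a) + eta + (s * (lambda * a) + lambda * a * s * kappa) / eta)%R.
  move=> mJ bJ aE sE eta0.
  exact: (void_probability (measurable_mark Phi Rad) M_law marks_independent
    X_marks_independent e_bij lambda_gt0 X_Campbell nu1_kappa X_second_order
    mJ bJ aE sE eta0).
have mu_no_atom (u : R * R) y : u != (0%R, 0%R) -> mu [set m | proj u m.1 = y] = 0.
  move=> u0; exact: (proj_no_atom (Phi_range 0%R) Phi_continuous y u0).
pose ell := fine mean_length.
have mhw : measurable_fun setT (fun m : R * R => (2 * half_width m)%R%:E).
  apply/measurable_EFinP/measurable_funM; first exact: measurable_cst.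
  exact: measurable_half_width.
have mean_lengthE : mean_length = \int[P]_w (2%:E * (Rad 0%R w)%:E).
  rewrite /mean_length unlock; apply: eq_integral => w _.
  by rewrite lebesgue_measure_centered_itv//= EFinM.
have mean_length_fin : mean_length \is a fin_num.
  rewrite ge0_fin_numE.
    rewrite mean_lengthE ge0_integralZl//; last 2 first.
    - exact/measurable_EFinP.
    - by move=> w _; rewrite lee_fin.
    by rewrite lte_mul_pinfty//; move: Rad_mean; rewrite unlock.
  rewrite mean_lengthE integral_ge0// => w _.
  by rewrite mule_ge0 ?lee_fin.
have ellE : \int[mu]_m (2 * half_width m)%R%:E = ell%:E.
  rewrite /ell fineK// mean_lengthE ge0_integral_distribution//; last first.
    by move=> m; rewrite lee_fin mulr_ge0 ?half_width_ge0.
  apply: eq_integral => w _ /=; rewrite -EFinM /half_width/= max_l//.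
have mK : measurable (K : set (measurableTypeR R * measurableTypeR R)%type).
  exact: closed_measurable2 (compact_closed (@norm_hausdorff _ _) K_compact).
have area_fin : area K \is a fin_num.
  by rewrite ge0_fin_numE ?compact_area_lty.
pose k := fine (area K).
have kE : area K = k%:E by rewrite fineK.
have k0 : (0 < k)%R by rewrite -lte_fin -kE; exact: interior_area_gt0.
pose F (rho : R) := 'E_P[fun w =>
  ((fine (area (cylinder_process X Phi Rad w `&` dilate rho K))
    / fine (area (dilate rho K))
    - (1 - expR (- (lambda * fine mean_length)))) ^+ 2)%R].
suff F_cvg (rho : nat -> R) : (forall n, (0 < rho n)%R) ->
    rho n @[n --> \oo] --> +oo%R -> F (rho n) @[n --> \oo] --> 0.
  apply/cvge_pinftyP => r r_y.
  (* only the eventually positive part of the sequence matters *)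
  pose r' n : R := if (0 < r n)%R then r n else 1%R.
  have r_eq : \forall n \near \oo, r' n = r n.
    by move/cvgryPgt : r_y => /(_ 0%R); apply: filterS => n; rewrite /r' => ->.
  have r'_y : r' n @[n --> \oo] --> +oo%R.
    by apply: cvg_trans r_y; apply: near_eq_cvg; apply: filterS r_eq.
  have r'_gt0 n : (0 < r' n)%R by rewrite /r'; case: ifPn.
  apply: cvg_trans (F_cvg _ r'_gt0 r'_y).
  by apply: near_eq_cvg; apply: filterS r_eq => n ->.
move=> rho_gt0 rho_y.
pose q := expR (- (lambda * ell)).
pose leb2 := (@lebesgue_measure R \x @lebesgue_measure R)%E.
pose kap0 : {measure set (measurableTypeR R * measurableTypeR R)%type -> \bar R} :=
  mrestr leb2 mK.
have kap0E A : kap0 A = area (A `&` K) by [].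
have [|kap kapE] := @sigma_finite_pack _ _ _ kap0.
  exists (fun=> setT); first by rewrite bigcup_const//; exists 0%N.
  by move=> _; split; rewrite // kap0E setTI kE ltry.
have kapT : kap setT = k%:E by rewrite kapE kap0E setTI.
pose H n : set (Omega * (measurableTypeR R * measurableTypeR R)) :=
  [set x | void X Phi Rad (strip (scale (rho n) x.2)) x.1].
have mH n : measurable (H n) by exact: measurable_void_scale.
have mpoint (z : (measurableTypeR R * measurableTypeR R)%type) : measurable [set z].
  rewrite (_ : [set z] = [set z.1] `*` [set z.2]); last first.
    by apply/seteqP; case: z => x y; split => -[a b] /= [-> ->].
  by apply: measurableX; exact: measurable_set1.
have kap_point z : kap [set z] = 0.
  apply/eqP; rewrite kapE kap0E eq_le measure_ge0 andbT -(area_point z).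
  by apply: le_measure; rewrite ?inE//; exact: measurableI.
have mdiag : measurable [set x : (measurableTypeR R * measurableTypeR R) *
    (measurableTypeR R * measurableTypeR R) | x.1 = x.2].
  pose Z := (measurableTypeR R * measurableTypeR R)%type.
  pose f1 (x : Z * Z) : R := (x.1.1 - x.2.1)%R.
  pose f2 (x : Z * Z) : R := (x.1.2 - x.2.2)%R.
  have mf1 : measurable_fun setT f1.
    apply: measurable_funB; first exact: (measurableT_comp measurable_fst measurable_fst).
    exact: (measurableT_comp measurable_fst measurable_snd).
  have mf2 : measurable_fun setT f2.
    apply: measurable_funB; first exact: (measurableT_comp measurable_snd measurable_fst).
    exact: (measurableT_comp measurable_snd measurable_snd).
  rewrite (_ : [set x | _] = f1 @^-1` [set 0%R] `&` f2 @^-1` [set 0%R]).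
    apply: measurableI; rewrite -[X in measurable X]setTI.
      by apply: mf1 => //; exact: measurable_set1.
    by apply: mf2 => //; exact: measurable_set1.
  apply/seteqP; split => -[[a b] [a' b']]; rewrite /f1 /f2 /=.
    by move=> [-> ->]; rewrite !subrr.
  by move=> [/eqP + /eqP]; rewrite !subr_eq0 => /eqP -> /eqP ->.
have ysH n z : ysection (H n) z = void X Phi Rad (strip (scale (rho n) z)).
  by apply/seteqP; split => w; rewrite /ysection /= inE.
have cvg1 (z : R * R) : z <> (0%R, 0%R) -> fine (P (ysection (H n) z)) @[n --> \oo] --> q.
  move=> /eqP z0; under eq_cvg do rewrite ysH.
  exact: (cvg_void_strip mu_no_atom ellE rho_gt0 rho_y V_bound z0).
have cvg2 (z z' : R * R) : z <> (0%R, 0%R) -> z' <> (0%R, 0%R) -> z <> z' ->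
    fine (P (ysection (H n) z `&` ysection (H n) z')) @[n --> \oo] --> (q ^+ 2)%R.
  move=> /eqP z0 /eqP z'0 /eqP zz'.
  under eq_cvg do rewrite !ysH -void_strip2.
  rewrite (_ : (q ^+ 2)%R = expR (- (lambda * (ell + ell)))); last first.
    by rewrite expr2 -expRD; congr expR; ring.
  exact: (cvg_void_strip2 mu_no_atom ellE rho_gt0 rho_y V_bound z0 z'0 zz').
have := mean_square_sections k0 kapT (expR_ge0 _) mpoint kap_point mdiag mH cvg1 cvg2.
apply: cvg_trans; apply: near_eq_cvg; apply: nearW => n.
rewrite /F unlock; apply: eq_integral => w _; congr (_%:E).
have mxH : measurable (xsection (H n) w) by exact: measurable_xsection.
have Xi_dilate : cylinder_process X Phi Rad w `&` dilate (rho n) K =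
    dilate (rho n) (K `\` xsection (H n) w).
  apply/seteqP; split => [z [+ [u Ku zE]]|z [u [Ku uH] <-]].
    rewrite -zE => Xiu; exists u => //; split => //; rewrite /xsection/= inE.
    by move=> /(cylinder_process_strip X Phi Rad_range).
  split; last by exists u.
  apply: contrapT => /(cylinder_process_strip X Phi Rad_range) h; apply: uH.
  by rewrite /xsection /= inE.
have areaD : area (K `\` xsection (H n) w) = (k - fine (kap (xsection (H n) w)))%:E.
  rewrite /area measureD//; last exact: compact_area_lty K_compact.
  have kapfin : kap (xsection (H n) w) \is a fin_num.
    rewrite ge0_fin_numE//; apply: le_lt_trans (ltry k).
    by rewrite -kapT; apply: le_measure; rewrite ?inE.
  by rewrite EFinB (fineK kapfin) kapE kap0E setIC -kE.
rewrite Xi_dilate !area_dilate//; last exact: measurableD.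
rewrite areaD kE -!EFinM /= -/ell -/q.
have -> : ((rho n ^+ 2 * (k - fine (kap (xsection (H n) w)))) / (rho n ^+ 2 * k) =
   1 - fine (kap (xsection (H n) w)) / k)%R.
  by field; rewrite !gt_eqF// ?exprn_gt0.
by ring.
Qed.
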